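(* Suppose that $\mathcal{C}\subseteq L^0_{c+}$ is non-empty. Let $$\mathcal{C}^\circ_{ca}:=\Big\{\mu\in ca_{c+}:\forall X\in\mathcal{C}\ \int X\,d\mu\le 1\Big\},\qquad \mathcal{C}^{\circ\circ}_{ca}:=\Big\{X\in L^0_{c+}:\forall\mu\in\mathcal{C}^\circ_{ca}\ \int X\,d\mu\le 1\Big\},$$ $$\mathcal{C}^\circ_{sca}:=\Big\{\mu\in sca_{c+}:\forall X\in\mathcal{C}\ \int X\,d\mu\le 1\Big\},\qquad \mathcal{C}^{\circ\circ}_{sca}:=\Big\{X\in L^0_{c+}:\forall\mu\in\mathcal{C}^\circ_{sca}\ \int X\,d\mu\le 1\Big\},$$ and $$\mathcal{C}^\circ:=\{(Q,Z)\in\mathfrak{P}_c(\Omega)\times L^\infty_{c+}:\forall X\in\mathcal{C}\ E_Q[ZX]\le 1\},\qquad \mathcal{C}^{\circ\circ}:=\{X\in L^0_{c+}:\forall (Q,Z)\in\mathcal{C}^\circ\ E_Q[ZX]\le 1\}.$$ Then: (i) $\mathcal{C}^{\circ\circ}_{ca}=\mathcal{C}^{\circ\circ}$. In particular, $\mathcal{C}=\mathcal{C}^{\circ\circ}_{ca}$ if and only if $\mathcal{C}$ is convex, solid, sequentially order closed, and $\mathcal{P}$-sensitive. (ii) If $\mathcal{C}$ is convex, solid, sequentially order closed, and $\mathcal{P}$-sensitive with a reduction set $\mathcal{Q}\subseteq sca_c$, then $\mathcal{C}=\mathcal{C}^{\circ\circ}=\mathcal{C}^{\circ\circ}_{sca}$.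 (iii) Both $\mathcal{C}^\circ_{ca}$ and $\mathcal{C}^\circ_{sca}$ are convex, solid, and $\sigma(ca_c,L^\infty_c)$-closed, respectively $\sigma(sca_c,L^\infty_c)$-closed. Here solid means that $\mu\in\mathcal{C}^\circ_{ca}$ (resp. $\mu\in\mathcal{C}^\circ_{sca}$) and $\nu\in ca_{c+}$ (resp. $\nu\in sca_{c+}$) with $\nu[A]\le\mu[A]$ for all $A\in\mathcal{F}$ imply $\nu\in\mathcal{C}^\circ_{ca}$ (resp. $\nu\in\mathcal{C}^\circ_{sca}$).
   Context: $(\Omega,\mathcal{F})$ is an arbitrary measurable space, $\mathfrak{P}(\Omega)$ the set of probability measures on it, and $\mathcal{P}\subseteq\mathfrak{P}(\Omega)$ a fixed non-empty set. Put $c[A]:=\sup_{P\in\mathcal{P}}P[A]$, $A\in\mathcal{F}$. An event $A$ is $\mathcal{P}$-polar if $c[A]=0$; a property holds $\mathcal{P}$-q.s. if it holds outside a $\mathcal{P}$-polar event. $ca$ is the space of countably additive finite-variation set functions $\mathcal{F}\to\mathbb{R}$; $ca_c$ consists of those $\mu\in ca$ with $\mu\ll\mathcal{P}$ (i.e. $|\mu|[N]=0$ for every $\mathcal{P}$-polar $N$); $ca_{c+}$ is the set of (non-negative) finite measures in $ca_c$; $\mathfrak{P}_c(\Omega):=\mathfrak{P}(\Omega)\cap ca_c$. A measure $\mu\in ca_{c+}$ is supported if there is $S(\mu)\in\mathcal{F}$ with $\mu[S(\mu)^c]=0$ and such that, for $N\in\mathcal{F}$, $\mu[N\cap S(\mu)]=0$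 implies that $N\cap S(\mu)$ is $\mathcal{P}$-polar. A signed $\mu\in ca_c$ is supported if its total variation $|\mu|$ is. $sca_c$ is the space of supported elements of $ca_c$, $sca_{c+}:=sca_c\cap ca_{c+}$. $L^0_c$ is the space of real-valued random variables on $(\Omega,\mathcal{F})$ modulo $\mathcal{P}$-q.s. equality, ordered by $X\preccurlyeq Y$ iff $X\le Y$ $\mathcal{P}$-q.s.; $L^\infty_c:=\{X\in L^0_c:\exists m>0\ |X|\preccurlyeq m\}$; $L^0_{c+}$, $L^\infty_{c+}$ are the positive cones. Integrals of $X\in L^0_c$ with respect to measures in $ca_c$ are evaluated on any representative (values in $[0,\infty]$ for $X\in L^0_{c+}$ and $\mu\in ca_{c+}$). $\sigma(ca_c,L^\infty_c)$ and $\sigma(sca_c,L^\infty_c)$ are the weak topologies induced by the pairing $(\mu,X)\mapsto\int X\,d\mu$. For $Q\in\mathfrak{P}_c(\Omega)$, $L^0_Q$ denotes random variables modulo $Q$-a.s. equality, and $j_Q:L^0_c\to L^0_Q$ maps the $\mathcal{P}$-q.s. class of $f$ to its $Q$-a.s. class. $\mathcal{C}\subseteq L^0_c$ is $\mathcal{P}$-sensitive if $\mathcal{C}=\bigcap_{Q\in\mathfrak{P}_c(\Omega)}j_Q^{-1}(j_Q(\mathcal{C}))$. A non-empty $\mathcal{Q}\subseteq\mathfrak{P}_c(\Omega)$ is a reduction set for $\mathcal{C}$ if $\mathcal{C}=\bigcap_{Q\in\mathcal{Q}}j_Q^{-1}(j_Q(\mathcal{C}))$. $\mathcal{C}\subseteq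 L^0_{c+}$ is solid if $X\in\mathcal{C}$, $Y\in L^0_{c+}$, $Y\preccurlyeq X$ imply $Y\in\mathcal{C}$. A sequence $(X_n)\subset L^0_c$ is order convergent to $X\in L^0_c$ if there is a decreasing sequence $(Y_n)\subset L^0_c$ with $\inf_n Y_n=0$ in $L^0_c$ and $|X_n-X|\preccurlyeq Y_n$ for all $n$. $\mathcal{C}\subseteq L^0_c$ is sequentially order closed if it contains every $X\in L^0_c$ that is the order limit of a sequence in $\mathcal{C}$. *)

(* Defs.v *)
From HB Require Import structures.
From mathcomp Require Import all_boot all_order all_algebra.
From mathcomp Require Import all_classical all_reals all_analysis.
From mathcomp Require Import measurable_realfun.

Set Implicit Arguments.
Unset Strict Implicit.
Unset Printing Implicit Defensive.

Import Order.TTheory GRing.Theory Num.Theory.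
Import numFieldNormedType.Exports.

Local Open Scope classical_set_scope.
Local Open Scope ring_scope.

Section quasi_sure.
Context {d : measure_display} {T : measurableType d} {R : realType}.
Implicit Types (Ps : set (probability T R)) (A N : set T).

Definition capacity Ps A : \bar R := ereal_sup [set P A | P in Ps].

Definition polar_event Ps N : Prop := measurable N /\ capacity Ps N = 0%E.

Definition qs Ps (S : T -> Prop) : Prop :=
  exists2 N, polar_event Ps N & forall w, ~ N w -> S w.

Lemma capacity0P Ps A : Ps !=set0 ->
  capacity Ps A = 0%E <-> forall P, Ps P -> P A = 0%E.
Proof.
move=> [P0 PsP0]; split => [cA0 P PsP|PA0].
  apply/eqP; rewrite eq_le measure_ge0 andbT -cA0.
  by apply: ereal_sup_ubound; exists P.
rewrite /capacity (_ : [set P A | P in Ps] = [set 0%E]) ?ereal_sup1//.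
apply/seteqP; split => [_ [P PsP <-]|_ ->]; first exact: PA0.
by exists P0 => //; exact: PA0.
Qed.

Lemma qsT Ps (S : T -> Prop) : Ps !=set0 -> (forall w, S w) -> qs Ps S.
Proof.
by move=> Ps0 ST; exists set0 => //; split => //; apply/capacity0P.
Qed.

Lemma qsI Ps (S1 S2 S : T -> Prop) : Ps !=set0 ->
  (forall w, S1 w -> S2 w -> S w) -> qs Ps S1 -> qs Ps S2 -> qs Ps S.
Proof.
move=> Ps0 S12 [N1 [mN1 /capacity0P cN1] h1] [N2 [mN2 /capacity0P cN2] h2].
exists (N1 `|` N2) => [|w /not_orP[/h1 ? /h2]]; last exact: S12.
split; first exact: measurableU.
apply/capacity0P => // P PsP; apply: null_set_setU => //.
- exact: cN1.
- exact: cN2.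
Qed.

End quasi_sure.

(** Non-emptiness of the set of priors is a parameter because quasi-sure
    equality is reflexive only under this condition. *)
Section L0c_type.
Context {d : measure_display} {T : measurableType d} {R : realType}.
Variables (Ps : set (probability T R)) (Ps0 : Ps !=set0).

Definition qs_eq (f g : {mfun T >-> R}) : bool :=
  `[< qs Ps (fun w => f w = g w) >].

Lemma qs_eq_refl : reflexive qs_eq.
Proof. by move=> f; apply/asboolP; exact: qsT. Qed.

Lemma qs_eq_sym : symmetric qs_eq.
Proof.
suff h f g : qs_eq f g -> qs_eq g f by move=> f g; apply/idP/idP; exact: h.
by move=> /asboolP fg; apply/asboolP; apply: (qsI Ps0 _ fg fg).
Qed.

Lemma qs_eq_trans : transitive qs_eq.
Proof.
move=> g f h /asboolP fg /asboolP gh; apply/asboolP.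
by apply: (qsI Ps0 _ fg gh) => w ->.
Qed.

Canonical qs_eq_equiv := EquivRel qs_eq qs_eq_refl qs_eq_sym qs_eq_trans.

Local Open Scope quotient_scope.

Definition L0c : Type := {eq_quot qs_eq}.
HB.instance Definition _ := Choice.on L0c.
HB.instance Definition _ := EqQuotient.on L0c.

Definition L0c_to_fun (X : L0c) : T -> R := repr X.
Coercion L0c_to_fun : L0c >-> Funclass.

Definition L0c_class (f : {mfun T >-> R}) : L0c := \pi f.

Lemma L0c_classK (X : L0c) : L0c_class (repr X) = X.
Proof. exact: reprK. Qed.

Lemma L0c_classE (f : {mfun T >-> R}) :
  qs Ps (fun w => repr (L0c_class f) w = f w).
Proof.
have /eqmodP/asboolP // : repr (L0c_class f) = f %[mod L0c] by rewrite reprK.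
Qed.

Lemma L0c_eqP (X Y : L0c) : X = Y <-> qs Ps (fun w => X w = Y w).
Proof.
split=> [->|XY]; first exact: qsT.
by rewrite -(L0c_classK X) -(L0c_classK Y); apply/eqmodP/asboolP.
Qed.

Definition L0c_add (X Y : L0c) : L0c := L0c_class (repr X + repr Y).
Definition L0c_opp (X : L0c) : L0c := L0c_class (- repr X).
Definition L0c_scale (a : R) (X : L0c) : L0c := L0c_class (a *: repr X).
Definition L0c_zero : L0c := L0c_class 0.

Lemma L0c_addE X Y : qs Ps (fun w => L0c_add X Y w = X w + Y w).
Proof. exact: L0c_classE. Qed.
Lemma L0c_oppE X : qs Ps (fun w => L0c_opp X w = - X w).
Proof. exact: L0c_classE. Qed.
Lemma L0c_scaleE a X : qs Ps (fun w => L0c_scale a X w = a * X w).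
Proof. exact: L0c_classE. Qed.
Lemma L0c_zeroE : qs Ps (fun w => L0c_zero w = 0).
Proof. exact: L0c_classE. Qed.

Lemma L0c_addA : associative L0c_add.
Proof.
move=> X Y Z; apply/L0c_eqP.
have h1 : qs Ps (fun w => L0c_add X (L0c_add Y Z) w = X w + (Y w + Z w)).
  by apply: (qsI Ps0 _ (L0c_addE X (L0c_add Y Z)) (L0c_addE Y Z)) => w -> ->.
have h2 : qs Ps (fun w => L0c_add (L0c_add X Y) Z w = X w + Y w + Z w).
  by apply: (qsI Ps0 _ (L0c_addE (L0c_add X Y) Z) (L0c_addE X Y)) => w -> ->.
by apply: (qsI Ps0 _ h1 h2) => w -> ->; rewrite addrA.
Qed.

Lemma L0c_addC : commutative L0c_add.
Proof.
move=> X Y; apply/L0c_eqP.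
by apply: (qsI Ps0 _ (L0c_addE X Y) (L0c_addE Y X)) => w -> ->; rewrite addrC.
Qed.

Lemma L0c_add0 : left_id L0c_zero L0c_add.
Proof.
move=> X; apply/L0c_eqP.
by apply: (qsI Ps0 _ (L0c_addE L0c_zero X) L0c_zeroE) => w -> ->; rewrite add0r.
Qed.

Lemma L0c_addN : left_inverse L0c_zero L0c_opp L0c_add.
Proof.
move=> X; apply/L0c_eqP.
have h : qs Ps (fun w => L0c_add (L0c_opp X) X w = 0).
  by apply: (qsI Ps0 _ (L0c_addE (L0c_opp X) X) (L0c_oppE X))
      => w -> ->; rewrite addNr.
by apply: (qsI Ps0 _ h L0c_zeroE) => w -> ->.
Qed.

HB.instance Definition _ :=
  GRing.isZmodule.Build L0c L0c_addA L0c_addC L0c_add0 L0c_addN.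

Lemma L0c_scaleA a b X : L0c_scale a (L0c_scale b X) = L0c_scale (a * b) X.
Proof.
apply/L0c_eqP.
have h : qs Ps (fun w => L0c_scale a (L0c_scale b X) w = a * (b * X w)).
  by apply: (qsI Ps0 _ (L0c_scaleE a (L0c_scale b X)) (L0c_scaleE b X))
      => w -> ->.
by apply: (qsI Ps0 _ h (L0c_scaleE (a * b) X)) => w -> ->; rewrite mulrA.
Qed.

Lemma L0c_scale1 : left_id 1 L0c_scale.
Proof.
move=> X; apply/L0c_eqP.
by apply: (qsI Ps0 _ (L0c_scaleE 1 X) (L0c_scaleE 1 X))
      => w -> _; rewrite mul1r.
Qed.

Lemma L0c_scaleDr : right_distributive L0c_scale +%R.
Proof.
move=> a X Y; apply/L0c_eqP.
have h1 : qs Ps (fun w => L0c_scale a (L0c_add X Y) w = a * (X w + Y w)).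
  by apply: (qsI Ps0 _ (L0c_scaleE a (L0c_add X Y)) (L0c_addE X Y)) => w -> ->.
have h2 : qs Ps (fun w => L0c_add (L0c_scale a X) (L0c_scale a Y) w
                          = a * X w + L0c_scale a Y w).
  by apply: (qsI Ps0 _ (L0c_addE (L0c_scale a X) (L0c_scale a Y)) (L0c_scaleE a X))
      => w -> ->.
have h3 : qs Ps (fun w => L0c_add (L0c_scale a X) (L0c_scale a Y) w
                          = a * X w + a * Y w).
  by apply: (qsI Ps0 _ h2 (L0c_scaleE a Y)) => w -> ->.
by apply: (qsI Ps0 _ h1 h3) => w -> ->; rewrite mulrDr.
Qed.

Lemma L0c_scaleDl X : {morph L0c_scale^~ X : a b / a + b}.
Proof.
move=> a b; apply/L0c_eqP.
have h2 : qs Ps (fun w => L0c_add (L0c_scale a X) (L0c_scale b X) w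
                          = a * X w + L0c_scale b X w).
  by apply: (qsI Ps0 _ (L0c_addE (L0c_scale a X) (L0c_scale b X)) (L0c_scaleE a X))
      => w -> ->.
have h3 : qs Ps (fun w => L0c_add (L0c_scale a X) (L0c_scale b X) w
                          = a * X w + b * X w).
  by apply: (qsI Ps0 _ h2 (L0c_scaleE b X)) => w -> ->.
by apply: (qsI Ps0 _ (L0c_scaleE (a + b) X) h3) => w -> ->; rewrite mulrDl.
Qed.

HB.instance Definition _ := GRing.Zmodule_isLmodule.Build R L0c
  L0c_scaleA L0c_scale1 L0c_scaleDr L0c_scaleDl.

Definition L0c_le (X Y : L0c) : bool := `[< qs Ps (fun w => X w <= Y w) >].

Lemma L0c_le_refl : reflexive L0c_le.
Proof. by move=> X; apply/asboolP; apply: qsT => // w; exact: lexx. Qed.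

Lemma L0c_le_anti : antisymmetric L0c_le.
Proof.
move=> X Y /andP[/asboolP XY /asboolP YX]; apply/L0c_eqP.
by apply: (qsI Ps0 _ XY YX) => w XYw YXw; apply/eqP; rewrite eq_le XYw YXw.
Qed.

Lemma L0c_le_trans : transitive L0c_le.
Proof.
move=> Y X Z /asboolP XY /asboolP YZ; apply/asboolP.
by apply: (qsI Ps0 _ XY YZ) => w; exact: le_trans.
Qed.

HB.instance Definition _ := Order.Le_isPOrder.Build ring_display L0c
  L0c_le_refl L0c_le_anti L0c_le_trans.

Definition L0c_abs (X : L0c) : L0c :=
  L0c_class [the {mfun T >-> R} of @Num.norm R R \o repr X].

Definition L0c_cst (m : R) : L0c := L0c_class [the {mfun T >-> R} of cst m].

Definition L0c_pos : set L0c := [set X | 0 <= X].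

Definition Linfc : set L0c :=
  [set X | exists2 m : R, 0 < m & L0c_abs X <= L0c_cst m].

Definition solid (C : set L0c) : Prop :=
  forall X Y, C X -> 0 <= Y -> Y <= X -> C Y.

Definition order_cvg (X_ : nat -> L0c) (X : L0c) : Prop :=
  exists Y_ : nat -> L0c, [/\ nonincreasing_seq Y_,
    infimums (range Y_) 0 & forall n, L0c_abs (X_ n - X) <= Y_ n].

Definition seq_order_closed (C : set L0c) : Prop :=
  forall (X_ : nat -> L0c) (X : L0c),
    (forall n, C (X_ n)) -> order_cvg X_ X -> C X.

End L0c_type.

Section sensitivity.
Context {d : measure_display} {T : measurableType d} {R : realType}.
Variables (Ps : set (probability T R)) (Ps0 : Ps !=set0).
Local Notation L0c := (L0c Ps0).

(** The set [Pc] is the intersection of the probability measures with [ca_c]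
    (defined below): a probability is its own total variation. *)
Definition Pc : set (probability T R) :=
  [set Q | forall N, polar_event Ps N -> Q N = 0%E].

Definition supported (mu : set T -> \bar R) : Prop :=
  exists S : set T, [/\ measurable S, mu (~` S) = 0%E &
    forall N, measurable N -> mu (N `&` S) = 0%E -> polar_event Ps (N `&` S)].

Local Open Scope quotient_scope.

(** [{mfun_ Q, T >-> R}] is the library's quotient of the measurable functions
    by [Q]-almost sure equality. *)
Definition jmap (Q : probability T R) (X : L0c) : {mfun_ Q, T >-> R} :=
  \pi_({mfun_ Q, T >-> R}) (repr X).

Definition Pc_sensitive (C : set L0c) : Prop :=
  C = \bigcap_(Q in Pc) (jmap Q @^-1` (jmap Q @` C)).

Definition reduction_set (Qs : set (probability T R)) (C : set L0c) : Prop :=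
  [/\ Qs !=set0, Qs `<=` Pc &
      C = \bigcap_(Q in Qs) (jmap Q @^-1` (jmap Q @` C))].

Local Open Scope ereal_scope.

Definition prob_polar (C : set L0c) : set (probability T R * L0c) :=
  [set QZ | [/\ Pc QZ.1, Linfc QZ.2, L0c_pos QZ.2 &
    forall X, C X -> 'E_QZ.1[(QZ.2 : T -> R) \* (X : T -> R)] <= 1]].

Definition prob_bipolar (C : set L0c) : set L0c :=
  [set X | L0c_pos X /\ forall QZ, prob_polar C QZ ->
    'E_QZ.1[(QZ.2 : T -> R) \* (X : T -> R)] <= 1].

End sensitivity.

(** Elements of [ca] are real set functions normalised to vanish outside the
    sigma-algebra, so that equality in [ca] is equality on measurable sets and
    [ca] is a vector space (which [{charge set T -> \bar R}] is not). Finiteness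
    of the variation is automatic for real-valued sigma-additive functions. *)
Section ca_type.
Context {d : measure_display} (T : measurableType d) (R : realType).

Definition ca_pred : {pred set T -> R^o} := mem [set m : set T -> R^o |
  [/\ m set0 = 0, semi_sigma_additive (fun A => (m A)%:E) &
      forall A, ~ measurable A -> m A = 0]].

Record ca := Ca { ca_fun :> set T -> R^o ; caP : ca_fun \in ca_pred }.

HB.instance Definition _ := [isSub for ca_fun].
HB.instance Definition _ := [Choice of ca by <:].

Definition ca_charge (mu : set T -> R^o) : set T -> \bar R :=
  fun A => (mu A)%:E.

Section ca_charge_of_pred.
Variables (m : set T -> R^o) (mP : m \in ca_pred).
Local Notation nu := (ca_charge m).

Lemma ca_charge0 : nu set0 = 0%E.
Proof. by have /set_mem[m0 _ _] := mP; rewrite /ca_charge m0. Qed.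

Lemma ca_charge_fin A : measurable A -> nu A \is a fin_num.
Proof. by []. Qed.

Lemma ca_charge_sigma : semi_sigma_additive nu.
Proof. by have /set_mem[] := mP. Qed.

#[local] HB.instance Definition _ := isCharge.Build d T R nu
  ca_charge0 ca_charge_fin ca_charge_sigma.

Definition charge_of_ca_pred : {charge set T -> \bar R} :=
  [the charge T R of nu].

End ca_charge_of_pred.

Lemma ca_submod_closed : submod_closed ca_pred.
Proof.
split=> [|a m1 m2 m1P m2P].
  rewrite inE; split=> // F mF tF mUF.
  under eq_fun do rewrite big1//.
  exact: cvg_cst.
have [_ _ m10] := set_mem m1P; have [_ _ m20] := set_mem m2P.
have [z1 _ _] := set_mem m1P; have [z2 _ _] := set_mem m2P.
rewrite inE; split.
- by rewrite /= !fctE z1 z2 scaler0 addr0.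
- pose nu := cadd (cscale a (charge_of_ca_pred m1P)) (charge_of_ca_pred m2P).
  rewrite (_ : (fun A => _) = nu); first exact: charge_semi_sigma_additive.
  by apply/funext => A.
- by move=> A nA; rewrite !fctE m10// m20// scaler0 addr0.
Qed.

HB.instance Definition _ :=
  GRing.isSubmodClosed.Build R _ ca_pred ca_submod_closed.
HB.instance Definition _ := [SubChoice_isSubLmodule of ca by <:].

Definition charge_of_ca (mu : ca) : {charge set T -> \bar R} :=
  charge_of_ca_pred (caP mu).

End ca_type.

Section signed_integral.
Context {d : measure_display} {T : measurableType d} {R : realType}.
Implicit Types (mu nu : ca T R).

(** The parts of the Jordan decomposition do not depend on the choice of a
    Hahn decomposition. *)
Definition ca_hahn mu :
    {PN : set T * set T | hahn_decomposition (charge_of_ca mu) PN.1 PN.2}.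
Proof.
apply: cid; have [P [N PN]] := Hahn_decomposition (charge_of_ca mu).
by exists (P, N).
Defined.

Definition ca_jpos mu : {finite_measure set T -> \bar R} :=
  jordan_pos (svalP (ca_hahn mu)).

Definition ca_jneg mu : {finite_measure set T -> \bar R} :=
  jordan_neg (svalP (ca_hahn mu)).

Definition total_variation mu : {measure set T -> \bar R} :=
  charge_variation (svalP (ca_hahn mu)).

Definition ca_integral mu (X : T -> R) : \bar R :=
  (\int[ca_jpos mu]_w (X w)%:E - \int[ca_jneg mu]_w (X w)%:E)%E.

End signed_integral.

Section measure_polars.
Context {d : measure_display} {T : measurableType d} {R : realType}.
Variables (Ps : set (probability T R)) (Ps0 : Ps !=set0).
Local Notation L0c := (L0c Ps0).
Local Notation ca := (ca T R).

Definition cac : set ca :=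
  [set mu | forall N, polar_event Ps N -> total_variation mu N = 0%E].

Definition cac_pos : set ca :=
  [set mu | cac mu /\ forall A, measurable A -> 0 <= mu A].

Definition scac : set ca :=
  [set mu | cac mu /\ supported Ps (total_variation mu)].

Definition scac_pos : set ca := scac `&` cac_pos.

(** Used with [M] equal to [cac_pos] or [scac_pos]. *)
Definition measure_polar (M : set ca) (C : set L0c) : set ca :=
  [set mu | M mu /\ forall X, C X -> (ca_integral mu X <= 1)%E].

Definition measure_bipolar (M : set ca) (C : set L0c) : set L0c :=
  [set X | L0c_pos X /\
    forall mu, measure_polar M C mu -> (ca_integral mu X <= 1)%E].

Definition solid_in (M D : set ca) : Prop :=
  forall mu nu, D mu -> M nu ->
    (forall A, measurable A -> nu A <= mu A) -> D nu.

(** For [M] equal to [cac] or [scac]: the topology on [M] induced by the maps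
    sending [mu] to the integral of [X], for [X] in [Linfc]. *)
Definition weak_topology_on (M : set ca) : topologicalType :=
  @initial_topology M {ptws (@Linfc d T R Ps Ps0) -> R}
    (fun mu X => fine (ca_integral (\val mu) (\val X))).

Definition weakly_closed_in (M D : set ca) : Prop :=
  closed [set mu : weak_topology_on M | D (\val (mu : M))].

End measure_polars.

(* Main.v *)
(** By sensitivity, a positive X outside C stays outside the image of C in
    [L^0_Q] for some Q.  There, minimise E_Q[(e^(-X) (X - f))^2] over the
    representatives f <= X of elements of C.  The parallelogram identity makes
    the increments of a minimising sequence f_k summable, so that
    sup_k inf_(j >= k) f_j is again a minimiser y; it belongs to C because only
    solidity and closedness under monotone limits are used.  The first-order
    condition at y says that the bounded weight Z = e^(-2X) (X - y) satisfies
    E_Q[Z f] <= E_Q[Z y] < E_Q[Z X] for all f in C, which is the bipolar theorem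
    for pairs (Q, Z).  Densities Z.Q and normalisation translate such pairs into
    measures of [ca_c] and back, and Z.Q is supported as soon as Q is. *)

Require Import Defs.
From mathcomp Require Import all_boot all_order all_algebra.
From mathcomp Require Import all_classical all_reals all_analysis.
From mathcomp Require Import measurable_realfun ring lra.

Set Implicit Arguments.
Unset Strict Implicit.
Unset Printing Implicit Defensive.

Import Order.TTheory GRing.Theory Num.Theory.
Import numFieldNormedType.Exports.

Local Open Scope classical_set_scope.
Local Open Scope ring_scope.

(** The obstacle is that [Q]-null sets need not be polar: a limit that exists only [Q]-almost
    surely, as an L^2 projection would give, says nothing about membership in [C]. The projection is
    therefore carried out on functions that are defined and compared at every point. The lower
    envelopes inf_(j >= k) f_j lie below f_k, so solidity keeps them in the class; they increase
    everywhere and stay below [X], so their limit exists everywhere and is an order limit of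
    elements of [C]. Since the envelopes lie below y <= X, y is at least as close to [X] as each of
    them. Hence only the cost of an envelope has to be estimated, and no passage to the limit under
    the integral is made. The summable increments serve exactly this estimate: they bound how far
    inf_(j >= k) f_j can fall below f_k. Unbounded members of the class enter through truncation,
    which solidity permits, followed by monotone convergence. *)

Lemma ge0_integral_truncation_le d (T : measurableType d) (R : realType)
    (mu : {measure set T -> \bar R}) (Z f : T -> R) (c : \bar R) :
  measurable_fun setT Z -> measurable_fun setT f ->
  (forall w, 0 <= Z w) -> (forall w, 0 <= f w) ->
  (forall n : nat, (\int[mu]_w (Z w * Num.min (f w) n%:R)%:E <= c)%E) ->
  (\int[mu]_w (Z w * f w)%:E <= c)%E.
Proof.
move=> mZ mf Z0 f0 hc.
pose g n w := (Z w * Num.min (f w) n%:R)%:E.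
have mg n : measurable_fun setT (g n).
  apply/measurable_EFinP/measurable_funM => //.
  exact: measurable_minr.
have g0 n w : setT w -> (0 <= g n w)%E.
  by move=> _; rewrite lee_fin mulr_ge0// le_min f0 ler0n.
have ndg w : setT w -> nondecreasing_seq (g ^~ w).
  move=> _ n p np; rewrite lee_fin ler_wpM2l// le_min ge_min lexx/=.
  by rewrite ge_min ler_nat np orbT.
have limg w : limn (g ^~ w) = (Z w * f w)%:E.
  apply/cvg_lim => //; apply: cvg_near_cst.
  exists (Num.truncn (f w)).+1 => // n /= fn.
  rewrite /g min_l// (le_trans (ltW (truncnS_gt _)))// ler_nat.
  exact: fn.
under eq_integral do rewrite -limg.
have := @cvg_monotone_convergence _ _ _ mu _ measurableT g mg g0 ndg.
move=> cg; rewrite -(cvg_lim _ cg)//; apply: lime_le; first exact: cvgP cg.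
exact: nearW.
Qed.

(** * Bounded functions and their real-valued integrals under a probability *)

Section bounded_measurable.
Context {d : measure_display} {T : measurableType d} {R : realType}.
Variable Q : probability T R.
Implicit Types f g h : T -> R.

(** A bound valid at every point is inherited by sums, products and squares, and it ensures that
    [Rintegral], a [fine] of an extended integral, is the true integral and behaves linearly. *)
Definition bounded_measurable h : Prop :=
  measurable_fun setT h /\ exists M, forall w, `|h w| <= M.

Lemma bounded_measurable_integrable h :
  bounded_measurable h -> Q.-integrable setT (EFin \o h).
Proof.
move=> [mh [M hM]]; apply: measurable_bounded_integrable => //.
  exact: (le_lt_trans (probability_le1 Q measurableT) (ltry 1)).
exists M; split; first exact: num_real.
by move=> x Mx w _; exact: le_trans (hM w) (ltW Mx).
Qed.

Lemma bounded_measurable_cst c : bounded_measurable (cst c).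
Proof. by split; [exact: measurable_cst|exists `|c|]. Qed.

Lemma bounded_measurableD f g : bounded_measurable f -> bounded_measurable g ->
  bounded_measurable (fun w => f w + g w).
Proof.
move=> [mf [M fM]] [mg [N gN]]; split; first exact: measurable_funD.
by exists (M + N) => w; rewrite (le_trans (ler_normD _ _))// lerD.
Qed.

Lemma bounded_measurableB f g : bounded_measurable f -> bounded_measurable g ->
  bounded_measurable (fun w => f w - g w).
Proof.
move=> [mf [M fM]] [mg [N gN]]; split; first exact: measurable_funB.
by exists (M + N) => w; rewrite (le_trans (ler_normB _ _))// lerD.
Qed.

Lemma bounded_measurableM f g : bounded_measurable f -> bounded_measurable g ->
  bounded_measurable (fun w => f w * g w).
Proof.
move=> [mf [M fM]] [mg [N gN]]; split; first exact: measurable_funM.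
by exists (M * N) => w; rewrite normrM ler_pM.
Qed.

Lemma bounded_measurableZ c f : bounded_measurable f ->
  bounded_measurable (fun w => c * f w).
Proof. exact/bounded_measurableM/bounded_measurable_cst. Qed.

Lemma bounded_measurable_sqr f : bounded_measurable f ->
  bounded_measurable (fun w => f w ^+ 2).
Proof. by move=> bf; exact: bounded_measurableM. Qed.

Lemma bounded_measurable_norm f : bounded_measurable f ->
  bounded_measurable (fun w => `|f w|).
Proof.
move=> [mf [M fM]]; split; first exact: measurableT_comp.
by exists M => w; rewrite normr_id.
Qed.

Local Notation I h := (Rintegral Q setT h).

Lemma bounded_measurable_EFin_Rintegral h : bounded_measurable h ->
  (I h)%:E = (\int[Q]_w (h w)%:E)%E.
Proof.
move=> bh; rewrite /Rintegral fineK//.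
exact/integrable_fin_num/bounded_measurable_integrable.
Qed.

Lemma ler_Rintegral f g : bounded_measurable f -> bounded_measurable g ->
  (forall w, f w <= g w) -> I f <= I g.
Proof.
move=> bf bg fg; apply: le_Rintegral => //;
  exact: bounded_measurable_integrable.
Qed.

Lemma Rintegral_linear2 (a b : R) f g :
  bounded_measurable f -> bounded_measurable g ->
  I (fun w => a * f w + b * g w) = a * I f + b * I g.
Proof.
move=> bf bg; rewrite RintegralD//.
- by rewrite !RintegralZl//; exact: bounded_measurable_integrable.
- exact/bounded_measurable_integrable/bounded_measurableZ.
- exact/bounded_measurable_integrable/bounded_measurableZ.
Qed.

Lemma Rintegral_probability_cst (c : R) : I (fun=> c) = c.
Proof. by rewrite Rintegral_cst//= probability_setT mulr1. Qed.

End bounded_measurable.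

(** * Projection of [X] on a solid convex class of non-negative functions *)

Section closest_point.
Context {d : measure_display} {T : measurableType d} {R : realType}.
Variables (Q : probability T R) (K : set (T -> R)) (X : T -> R).
Hypotheses (K_measurable : forall f, K f -> measurable_fun setT f)
  (K_ge0 : forall f, K f -> forall w, 0 <= f w)
  (K_nonempty : K !=set0)
  (K_convex : forall f g (t : R), K f -> K g -> 0 <= t -> t <= 1 ->
    K (fun w => t * f w + (1 - t) * g w))
  (K_solid : forall f (g : T -> R), K f -> measurable_fun setT g ->
    (forall w, 0 <= g w <= f w) -> K g)
  (K_nondecreasing_lim : forall (f_ : nat -> T -> R) (f : T -> R),
    (forall n, K (f_ n)) ->
    (forall w, nondecreasing_seq (f_ ^~ w)) -> measurable_fun setT f ->
    (forall w, f_ ^~ w @ \oo --> f w) -> K f).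
Hypotheses (mX : measurable_fun setT X) (X_ge0 : forall w, 0 <= X w).

Local Notation I h := (Rintegral Q setT h).

(* This weight makes [wt], [wt * X] and hence all the functions integrated
   below bounded. *)
Let wt w := expR (- X w).
Let gap (f : T -> R) w := wt w * (X w - f w).
(** The constraint by [X] puts [gap f] in [0, 1], keeps increasing limits finite at every point, and
    makes the separating weight built from the minimiser non-negative. *)
Let D := [set f : T -> R | K f /\ forall w, f w <= X w].
Let phi (f : T -> R) := I (fun w => gap f w ^+ 2).

Let wt_gt0 w : 0 < wt w. Proof. exact: expR_gt0. Qed.

Let wt_ge0 w : 0 <= wt w. Proof. exact: ltW. Qed.

Let wt_le1 w : wt w <= 1.
Proof. by rewrite -expR0 ler_expR oppr_le0. Qed.

Let wtX_le1 w : wt w * X w <= 1.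
Proof.
rewrite /wt expRN mulrC ler_pdivrMr ?expR_gt0// mul1r.
by rewrite (le_trans _ (expR_ge1Dx _))// lerDr.
Qed.

Let m_wt : measurable_fun setT wt.
Proof. by apply: measurableT_comp => //; exact: measurable_funN. Qed.

Let m_gap (f : T -> R) : measurable_fun setT f -> measurable_fun setT (gap f).
Proof.
by move=> mf; apply: measurable_funM => //; exact: measurable_funB.
Qed.

Let gap_ge0 f w : D f -> 0 <= gap f w.
Proof. by move=> [_ fX]; rewrite mulr_ge0 ?wt_ge0// subr_ge0. Qed.

Let gap_le1 f w : D f -> gap f w <= 1.
Proof.
move=> [Kf _]; apply: le_trans (wtX_le1 w).
by rewrite ler_wpM2l ?wt_ge0// gerBl K_ge0.
Qed.

Let bounded_gap f : D f -> bounded_measurable (gap f).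
Proof.
move=> Df; split; first by apply: m_gap; apply: K_measurable; case: Df.
by exists 1 => w; rewrite ger0_norm ?gap_ge0 ?gap_le1.
Qed.

Let bounded_gap_sqr f : D f -> bounded_measurable (fun w => gap f w ^+ 2).
Proof. by move=> Df; exact/bounded_measurable_sqr/bounded_gap. Qed.

Let K0 : K (fun=> 0).
Proof.
have [f Kf] := K_nonempty; apply: (K_solid Kf) => // w.
by rewrite lexx K_ge0.
Qed.

Let D0 : D (fun=> 0). Proof. by split. Qed.

Let D_convex f g (t : R) : D f -> D g -> 0 <= t -> t <= 1 ->
  D (fun w => t * f w + (1 - t) * g w).
Proof.
move=> [Kf fX] [Kg gX] t0 t1; split; first exact: K_convex.
move=> w; rewrite [leRHS](_ : _ = t * X w + (1 - t) * X w); last by ring.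
by rewrite lerD// ler_wpM2l// subr_ge0.
Qed.

Let has_inf_phi : has_inf (phi @` D).
Proof.
split; first by exists (phi (fun=> 0)), (fun=> 0).
by exists 0 => _ [f _ <-]; apply: Rintegral_ge0 => w _; exact: sqr_ge0.
Qed.

Let m := inf (phi @` D).

Let m_le f : D f -> m <= phi f.
Proof.
by move=> Df; apply: ge_inf; [exact: has_inf_phi.2|exists f].
Qed.

Let bounded_diff f g : D f -> D g ->
  bounded_measurable (fun w => wt w * (f w - g w)).
Proof.
move=> Df Dg; rewrite (_ : (fun _ => _) = fun w => gap g w - gap f w).
  exact: bounded_measurableB (bounded_gap Dg) (bounded_gap Df).
by apply/funext => w; rewrite /gap; ring.
Qed.

(* Parallelogram identity at the midpoint of [f] and [g]. *)
Let diff_le f g : D f -> D g ->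
  I (fun w => (wt w * (f w - g w)) ^+ 2) <= 2 * (phi f - m) + 2 * (phi g - m).
Proof.
move=> Df Dg; have h0 : (0 : R) <= 2^-1 by lra.
have h1 : 2^-1 <= 1 :> R by lra.
have Dfg := D_convex Df Dg h0 h1.
have e : phi f + phi g = 2 * phi (fun w => 2^-1 * f w + (1 - 2^-1) * g w) +
    2^-1 * I (fun w => (wt w * (f w - g w)) ^+ 2).
  rewrite -Rintegral_linear2; [|exact: bounded_gap_sqr|].
    have -> : phi f + phi g = 1 * phi f + 1 * phi g by rewrite !mul1r.
    rewrite -Rintegral_linear2; [|exact: bounded_gap_sqr..].
    by apply: eq_Rintegral => w _; rewrite /gap; field.
  exact/bounded_measurable_sqr/bounded_diff.
by have := m_le Dfg; lra.
Qed.

(** By the parallelogram bound the squared weighted distance is at most 4 c^3. AM-GM with parameter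
    c turns it into c / 2 + 2 c^2, and c <= 1 leaves a bound linear in c, which is summable along c
    = 2^-k. *)
Let increment_le f g c : D f -> D g -> 0 < c -> c <= 1 ->
  phi f <= m + c ^+ 3 -> phi g <= m + c ^+ 3 ->
  I (fun w => wt w * `|g w - f w|) <= 3 * c.
Proof.
move=> Df Dg c0 c1 fc gc.
have bd := bounded_diff Dg Df.
(* AM-GM: [z <= c / 2 + z ^+ 2 / (2 * c)] *)
apply: (@le_trans _ _ (2^-1 * c * I (fun=> 1) +
    (2 * c)^-1 * I (fun w => (wt w * (g w - f w)) ^+ 2))).
  rewrite -Rintegral_linear2; [|exact: bounded_measurable_cst|
    exact: bounded_measurable_sqr].
  apply: ler_Rintegral.
  - rewrite (_ : (fun _ => _) = fun w => `|wt w * (g w - f w)|).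
      exact: bounded_measurable_norm.
    by apply/funext => w; rewrite normrM (gtr0_norm (wt_gt0 w)).
  - apply: bounded_measurableD.
      exact/bounded_measurableZ/bounded_measurable_cst.
    exact/bounded_measurableZ/bounded_measurable_sqr.
  move=> w; rewrite -{1}(gtr0_norm (wt_gt0 w)) -normrM.
  set z := wt w * _; rewrite -(real_normK (num_real z)) -subr_ge0.
  rewrite (_ : _ - _ = (2 * c)^-1 * (`|z| - c) ^+ 2).
    by rewrite mulr_ge0 ?sqr_ge0// invr_ge0 mulr_ge0// ltW.
  by field; rewrite gt_eqF.
rewrite Rintegral_probability_cst mulr1.
have h : I (fun w => (wt w * (g w - f w)) ^+ 2) <= 4 * c ^+ 3.
  by have := diff_le Dg Df; lra.
apply: (@le_trans _ _ (2^-1 * c + (2 * c)^-1 * (4 * c ^+ 3))).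
  by rewrite lerD2l ler_wpM2l// invr_ge0 mulr_ge0// ltW.
rewrite (_ : (2 * c)^-1 * _ = 2 * (c * c)); last by field; rewrite gt_eqF.
suff : c * c <= c by lra.
by rewrite ger_pMr.
Qed.

Section minimizing_sequence.
Variable f_ : nat -> T -> R.
Hypotheses (Df : forall k, D (f_ k))
  (phif : forall k, phi (f_ k) <= m + (2^-1 ^+ k) ^+ 3).

Let Delta k w := wt w * `|f_ k.+1 w - f_ k w|.

Let half_exp_gt0 k : 0 < 2^-1 ^+ k :> R. Proof. by rewrite exprn_gt0. Qed.
Let half_exp_le1 k : 2^-1 ^+ k <= 1 :> R.
Proof. by rewrite exprn_ile1// invf_le1// ler1n. Qed.

Let half_exp_cvg0 : 2^-1 ^+ k @[k --> \oo] --> (0 : R).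
Proof. by apply: cvg_expr; rewrite ger0_norm// invf_lt1// ltr1n. Qed.

Let Delta_ge0 k w : 0 <= Delta k w.
Proof. by rewrite mulr_ge0// ltW. Qed.

Let m_Delta k : measurable_fun setT (Delta k).
Proof.
apply: measurable_funM => //; apply: measurableT_comp => //.
by apply: measurable_funB; apply: K_measurable; case: (Df k); case: (Df k.+1).
Qed.

Let bounded_Delta k : bounded_measurable (Delta k).
Proof.
rewrite (_ : Delta k = fun w => `|wt w * (f_ k.+1 w - f_ k w)|).
  exact/bounded_measurable_norm/bounded_diff.
by apply/funext => w; rewrite normrM (gtr0_norm (wt_gt0 w)).
Qed.

Let Delta_le k : I (Delta k) <= 3 * 2^-1 ^+ k.
Proof.
apply: increment_le => //; apply: le_trans (phif _) _.
rewrite lerD2l lerXn2r ?nnegrE ?(ltW (half_exp_gt0 _))// exprS.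
by rewrite ger_pMl ?invf_le1 ?ler1n.
Qed.

Let G k w := infs (f_ ^~ w) k.

Let f_lb w : has_lbound (range (f_ ^~ w)).
Proof. by exists 0 => _ [k _ <-]; apply: K_ge0; case: (Df k). Qed.

Let G_le k j w : (k <= j)%N -> G k w <= f_ j w.
Proof.
move=> kj; apply: ge_inf; last by exists j.
by exists 0 => _ [i _ <-]; apply: K_ge0; case: (Df i).
Qed.

Let le_G k (x : R) w : (forall j, (k <= j)%N -> x <= f_ j w) -> x <= G k w.
Proof.
move=> xf; apply: lb_le_inf; first by exists (f_ k w), k => //=.
by move=> _ [j /= kj <-]; exact: xf.
Qed.

Let m_G k : measurable_fun setT (G k).
Proof.
by apply: measurable_fun_infs => // n; apply: K_measurable; case: (Df n).
Qed.

Let DG k : D (G k).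
Proof.
split=> [|w]; last by apply: le_trans (G_le _ (leqnn k)) _; case: (Df k).
have [Kf _] := Df k.
apply: (K_solid Kf) => // w; rewrite G_le// andbT.
by apply: le_G => j _; apply: K_ge0; case: (Df j).
Qed.

Let nd_G w : nondecreasing_seq (G ^~ w).
Proof. exact: nondecreasing_infs. Qed.

Let y w := limn (G ^~ w).

Let G_cvg w : G ^~ w @ \oo --> y w.
Proof.
apply: nondecreasing_is_cvgn => //.
by exists (X w) => _ [k _ <-]; case: (DG k).
Qed.

Let m_y : measurable_fun setT y.
Proof. by apply: (@measurable_fun_cvg _ _ _ _ G) => // w _; exact: G_cvg. Qed.

Let G_le_y k w : G k w <= y w.
Proof.
exact: (@nondecreasing_cvgn_le _ (G ^~ w) (nd_G w) (@G_cvg w) k).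
Qed.

Let Dy : D y.
Proof.
split; first by apply: (@K_nondecreasing_lim G) => // k; case: (DG k).
move=> w; apply: limr_le; first exact: (@G_cvg w).
by apply: nearW => k; case: (DG k).
Qed.

(** Telescoping bounds the weighted drop from [f_ k] to any later [f_ j], hence to their infimum, by
    the sum of the increments. The series lives in the extended reals because it may diverge at some
    points, where the bound is trivial. *)
Let gap_G_le k w : ((gap (G k) w ^+ 2)%:E <=
  (gap (f_ k) w ^+ 2)%:E + \sum_(i <oo) (2 * Delta (k + i) w)%:E)%E.
Proof.
have S0 n : (0 <= (2 * Delta (k + n) w)%:E)%E by rewrite lee_fin mulr_ge0.
have tele n : wt w * (f_ k w - f_ (k + n) w) <=
    \sum_(0 <= i < n) Delta (k + i) w.
  elim: n => [|n ih]; first by rewrite big_nil addn0 subrr mulr0.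
  rewrite big_nat_recr//= addnS.
  rewrite (_ : _ * _ = wt w * (f_ k w - f_ (k + n) w) +
                       wt w * (f_ (k + n) w - f_ (k + n).+1 w)); last by ring.
  by rewrite lerD// ler_wpM2l ?wt_ge0// distrC ler_norm.
have [Soo|] := eqVneq (\sum_(i <oo) (2 * Delta (k + i) w)%:E)%E +oo%E.
  by rewrite Soo addey// leey.
rewrite -ltey => Sfin.
have Sfn : (\sum_(i <oo) (2 * Delta (k + i) w)%:E)%E \is a fin_num.
  by rewrite ge0_fin_numE// nneseries_ge0.
have Sub n : 2 * (wt w * (f_ k w - f_ (k + n) w)) <=
    fine (\sum_(i <oo) (2 * Delta (k + i) w)%:E)%E.
  rewrite -lee_fin fineK//.
  apply: (@le_trans _ _ (\sum_(0 <= i < n) (2 * Delta (k + i) w)%:E)%E).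
    by rewrite sumEFin lee_fin -mulr_sumr ler_wpM2l.
  exact: nneseries_lim_ge.
rewrite -(fineK Sfn); set s := fine _ in Sub *.
have wt2_gt0 : 0 < 2 * wt w by rewrite mulr_gt0.
have GS : f_ k w - (2 * wt w)^-1 * s <= G k w.
  apply: le_G => j kj; rewrite lerBlDl -lerBlDr ler_pdivlMl// -mulrA.
  by have := Sub (j - k)%N; rewrite subnKC.
have h : 2 * (wt w * (f_ k w - G k w)) <= s.
  by rewrite mulrA -ler_pdivlMl// lerBlDl -lerBlDr.
have a0 := gap_ge0 w (Df k); have b1 := gap_le1 w (DG k).
have a1 := gap_le1 w (Df k); have b0 := gap_ge0 w (DG k).
rewrite -EFinD lee_fin.
have hd : gap (G k) w - gap (f_ k) w = wt w * (f_ k w - G k w).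
  by rewrite /gap; ring.
have ab : gap (f_ k) w <= gap (G k) w.
  by rewrite -subr_ge0 hd mulr_ge0 ?wt_ge0// subr_ge0 G_le.
(* For 0 <= a <= b <= 1, b^2 - a^2 = (b - a) (b + a) <= 2 (b - a); this is the factor 2 in front of
   [Delta]. *)
move: hd h; nra.
Qed.

(** Integrating the pointwise bound gives three contributions: m + (2^-k)^3 from [f_ k], then the
    sum over i of 2 * 3 * 2^-(k+i), which is 12 * 2^-k. The cube is absorbed into one more 2^-k,
    whence 13. *)
Let phi_G_le k : phi (G k) <= m + 13 * 2^-1 ^+ k.
Proof.
have bd i : bounded_measurable (fun w => 2 * Delta (k + i) w).
  exact: bounded_measurableZ.
have md i : measurable_fun setT (fun w => (2 * Delta (k + i) w)%:E).
  by apply/measurable_EFinP; case: (bd i).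
have d0 i w : (0 <= (2 * Delta (k + i) w)%:E)%E by rewrite lee_fin mulr_ge0.
rewrite -lee_fin bounded_measurable_EFin_Rintegral; last exact: bounded_gap_sqr.
apply: (@le_trans _ _ (\int[Q]_w ((gap (f_ k) w ^+ 2)%:E +
    \sum_(i <oo) (2 * Delta (k + i) w)%:E))%E).
  apply: ge0_le_integral => //.
  - by move=> w _; rewrite lee_fin sqr_ge0.
  - by apply/measurable_EFinP; case: (bounded_gap_sqr (DG k)).
  - apply: emeasurable_funD.
      by apply/measurable_EFinP; case: (bounded_gap_sqr (Df k)).
    by apply: ge0_emeasurable_sum.
rewrite ge0_integralD//; last 4 first.
  - by move=> w _; rewrite lee_fin sqr_ge0.
  - by apply/measurable_EFinP; case: (bounded_gap_sqr (Df k)).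
  - by move=> w _; exact: nneseries_ge0.
  - exact: ge0_emeasurable_sum.
rewrite -bounded_measurable_EFin_Rintegral; last exact: bounded_gap_sqr.
rewrite integral_nneseries//.
apply: (@le_trans _ _ ((m + (2^-1 ^+ k) ^+ 3)%:E + (12 * 2^-1 ^+ k)%:E)%E).
  apply: leeD; first by rewrite lee_fin phif.
  apply: le_trans (epsilon_trick0 xpredT _); last first.
    by rewrite mulr_ge0// ltW.
  apply: lee_nneseries => i _.
    by move=> _; apply: integral_ge0.
  rewrite -bounded_measurable_EFin_Rintegral// lee_fin RintegralZl//; last first.
    exact: bounded_measurable_integrable.
  apply: (@le_trans _ _ (2 * (3 * 2^-1 ^+ (k + i)))).
    by rewrite ler_wpM2l.
  rewrite exprD natrX exprS (exprVn _ i) le_eqVlt; apply/orP; left.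
  by apply/eqP; field; rewrite expf_neq0.
rewrite -EFinD lee_fin -addrA lerD2l.
suff : (2^-1 ^+ k) ^+ 3 <= 2^-1 ^+ k :> R by lra.
by rewrite exprS ger_pMr// exprn_ile1// ltW.
Qed.

(** From [G k] <= y <= [X] the gap of y is at most that of [G k], so [phi y] is bounded by every
    [phi (G k)], and these bounds tend to [m]. *)
Lemma liminf_minimizes : D y /\ phi y <= m.
Proof.
split=> //.
have h k : phi y <= m + 13 * 2^-1 ^+ k.
  apply: le_trans (phi_G_le k).
  apply: ler_Rintegral => [||w]; [exact: bounded_gap_sqr..|].
  rewrite lerXn2r ?nnegrE ?gap_ge0//.
  by rewrite ler_wpM2l ?wt_ge0// lerD2l lerN2.
have c : m + 13 * 2^-1 ^+ k @[k --> \oo] --> (m + 13 * 0 : R).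
  by apply: cvgD; [exact: cvg_cst|apply: cvgM => //; exact: cvg_cst].
rewrite -[m]addr0 -[X in m + X](mulr0 13) -(cvg_lim _ c)//.
by apply: limr_ge; [exact: cvgP c|exact: nearW].
Qed.

End minimizing_sequence.

Let exists_minimizer : exists2 y, D y & forall f, D f -> phi y <= phi f.
Proof.
have /choice[f_ Hf] (k : nat) : exists f, D f /\ phi f <= m + (2^-1 ^+ k) ^+ 3.
  have k0 : 0 < (2^-1 ^+ k) ^+ 3 :> R by rewrite !exprn_gt0.
  have [_ [f Df <-] /ltW fm] := inf_adherent k0 has_inf_phi.
  by exists f.
have [Dy ym] := liminf_minimizes (fun k => (Hf k).1) (fun k => (Hf k).2).
by eexists; [exact: Dy|move=> f Df; exact: le_trans ym (m_le Df)].
Qed.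

(** Moving from y towards f by a step t changes [phi] by at most -2 t A + t^2 B, which minimality
    forces to be non-negative; a positive A would violate this for a suitable t. The bound [N] makes
    the direction b, and so A and B, finite. *)
Let first_order_condition y f (N : R) :
  D y -> (forall g, D g -> phi y <= phi g) -> K f -> (forall w, f w <= N) ->
  I (fun w => gap y w * (wt w * (f w - y w))) <= 0.
Proof.
move=> Dy ymin Kf fN; have [Ky yX] := Dy.
pose b w := wt w * (f w - y w).
have bb : bounded_measurable b.
  split; first by apply: measurable_funM => //; apply: measurable_funB;
    exact: K_measurable.
  exists (N + 1) => w.
  rewrite /b mulrBr (le_trans (ler_normB _ _))//.
  rewrite !ger0_norm ?mulr_ge0 ?wt_ge0 ?K_ge0//.
  apply: lerD.
    by rewrite (le_trans _ (fN w))// ler_piMl// K_ge0.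
  by apply: le_trans (wtX_le1 w); rewrite ler_wpM2l// ltW.
have bab : bounded_measurable (fun w => gap y w * b w).
  exact/bounded_measurableM/bb/bounded_gap.
set A := I (fun w => gap y w * (wt w * (f w - y w))).
set B := I (fun w => b w ^+ 2).
have B0 : 0 <= B by apply: Rintegral_ge0 => w _; exact: sqr_ge0.
have variation t : 0 <= t -> t <= 1 -> 0 <= - (2 * t) * A + t ^+ 2 * B.
  move=> t0 t1.
  (* The convex combination may exceed [X]. Cutting it at [X] returns to [D] by solidity, and where
     the cut acts the gap becomes 0, so the cost does not exceed the quadratic expression. *)
  pose g w := Num.min (t * f w + (1 - t) * y w) (X w).
  have Kt := K_convex Kf Ky t0 t1.
  have Dg : D g.
    split; last by move=> w; rewrite /g ge_min lexx orbT.
    apply: (K_solid Kt).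
      by apply: measurable_minr => //; exact: K_measurable.
    by move=> w; rewrite /g ge_min lexx le_min X_ge0 (K_ge0 Kt).
  suff : phi g <= phi y + - (2 * t) * A + t ^+ 2 * B.
    by have := ymin _ Dg; lra.
  have -> : phi y + - (2 * t) * A + t ^+ 2 * B =
      1 * (1 * phi y + - (2 * t) * A) + t ^+ 2 * B by ring.
  have bgb : bounded_measurable
      (fun w => 1 * gap y w ^+ 2 + - (2 * t) * (gap y w * b w)).
    by apply: bounded_measurableD; apply: bounded_measurableZ => //;
      exact: bounded_gap_sqr.
  rewrite -Rintegral_linear2//; last exact: bounded_gap_sqr.
  rewrite -Rintegral_linear2//; last exact: bounded_measurable_sqr.
  apply: ler_Rintegral; first exact: bounded_gap_sqr.
    by apply: bounded_measurableD; apply: bounded_measurableZ => //;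
      exact: bounded_measurable_sqr.
move=> w; rewrite -/(b w) (_ : 1 * _ + _ = (gap y w - t * b w) ^+ 2); last by ring.
  have -> : gap y w - t * b w =
      wt w * (X w - (t * f w + (1 - t) * y w)) by rewrite /gap /b; ring.
  rewrite !exprMn ler_wpM2l ?sqr_ge0// /g; set z := t * _ + _.
  by case: (leP z (X w)) => // _; rewrite subrr expr0n sqr_ge0.
rewrite leNgt; apply/negP => A0.
(* The step t = A / (A + B) lies in (0, 1] even if B = 0. The variation yields t B >= 2 A, whereas t
   (A + B) = A yields t B <= A, contradicting A > 0. *)
have AB0 : 0 < A + B by rewrite ltr_wpDr.
have t1 : A / (A + B) <= 1 by rewrite ler_pdivrMr// mul1r lerDl.
have t0 : 0 < A / (A + B) by rewrite divr_gt0.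
have := variation _ (ltW t0) t1.
have : A / (A + B) * (A + B) = A by rewrite divfK// gt_eqF.
move: t0; move: (A / (A + B)) => t t0 tAB h.
have h2 : 0 <= t * (t * B - 2 * A) by move: h; congr (0 <= _); ring.
move: h2; rewrite pmulr_rge0// => h2.
have : t * B <= A by rewrite -tAB mulrDr ler_wpDl// mulr_ge0// ltW.
lra.
Qed.

(** If the distance from [X] to the class vanishes, the minimiser equals [X] almost surely, as [wt]
    is positive. Otherwise the weight [wt * gap y] separates: by construction its integral against
    [X - y] is [phi y] > 0. *)
Lemma solid_convex_separation :
  (exists2 f, K f & {ae Q, forall w, f w = X w}) \/
  exists Z : T -> R, [/\ bounded_measurable Z, forall w, 0 <= Z w,
    forall f, K f -> (\int[Q]_w (Z w * f w)%:E <= 1)%E &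
    (1 < \int[Q]_w (Z w * X w)%:E)%E].
Proof.
have [y Dy ymin] := exists_minimizer; have [Ky yX] := Dy.
have phi0 : 0 <= phi y by apply: Rintegral_ge0 => w _; exact: sqr_ge0.
have bgap := bounded_gap Dy.
have [phiy0|phiyN0] := eqVneq (phi y) 0; [left|right].
  exists y => //.
  have /ae_eq_integral_abs : measurable_fun setT (fun w => (gap y w ^+ 2)%:E).
    by apply/measurable_EFinP; case: (bounded_gap_sqr Dy).
  move=> /(_ Q measurableT)[+ _]; under eq_integral do
    rewrite gee0_abs ?lee_fin ?sqr_ge0//.
  rewrite -bounded_measurable_EFin_Rintegral; last exact: bounded_gap_sqr.
  rewrite -/(phi y) phiy0 => /(_ erefl); apply: filterS => w /(_ Logic.I)[].
  move/eqP; rewrite sqrf_eq0 mulf_eq0 gt_eqF//= subr_eq0 => /eqP.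
  by [].
have phigt0 : 0 < phi y by rewrite lt_def phiyN0.
pose Z w := wt w * gap y w.
have bwt : bounded_measurable wt.
  by split=> //; exists 1 => w; rewrite ger0_norm// ltW.
have bZ : bounded_measurable Z by exact: bounded_measurableM.
have Z0 w : 0 <= Z w by exact: mulr_ge0 (wt_ge0 w) (gap_ge0 w Dy).
have bwty : bounded_measurable (fun w => wt w * y w).
  split; first by apply: measurable_funM => //; exact: K_measurable.
  exists 1 => w; rewrite ger0_norm; last by rewrite mulr_ge0 ?wt_ge0 ?K_ge0.
  by apply: le_trans (wtX_le1 w); rewrite ler_wpM2l// ltW.
have bZy : bounded_measurable (fun w => Z w * y w).
  rewrite (_ : (fun _ => _) = fun w => gap y w * (wt w * y w)).
    exact: bounded_measurableM.
  by apply/funext => w; rewrite /Z; ring.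
(* The level c is the midpoint between the integrals of Z y and Z X, which differ by [phi y]. It is
   thus positive even if the integral of Z y is 0, so that dividing by c normalises the separating
   level to 1. *)
pose c := I (fun w => Z w * y w) + 2^-1 * phi y.
have Zy0 : 0 <= I (fun w => Z w * y w).
  by apply: Rintegral_ge0 => w _; rewrite mulr_ge0// K_ge0.
have c0 : 0 < c by rewrite ltr_wpDl// mulr_gt0.
exists (fun w => c^-1 * Z w); split.
- exact: bounded_measurableZ.
- by move=> w; rewrite mulr_ge0// invr_ge0 ltW.
- move=> f Kf; apply: ge0_integral_truncation_le.
  + by case: (bounded_measurableZ c^-1 bZ).
  + exact: K_measurable.
  + by move=> w; rewrite mulr_ge0// invr_ge0 ltW.
  + exact: K_ge0.
  (* The first-order condition needs a bounded competitor; the truncation of f is one, and it stays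
     in [K] by solidity. *)
  move=> n; pose g w := Num.min (f w) n%:R.
  have Kg : K g.
    apply: (K_solid Kf).
      by apply: measurable_minr => //; exact: K_measurable.
    by move=> w; rewrite /g le_min K_ge0// ler0n ge_min lexx.
  have bg : bounded_measurable g.
    split; first exact: K_measurable.
    by exists n%:R => w; rewrite ger0_norm ?K_ge0// /g ge_min lexx orbT.
  have gn w : g w <= n%:R by rewrite /g ge_min lexx orbT.
  have foc := first_order_condition Dy ymin Kg gn.
  have bZg : bounded_measurable (fun w => Z w * g w).
    exact: bounded_measurableM.
  have -> : (\int[Q]_w (c^-1 * Z w * Num.min (f w) n%:R)%:E =
      (c^-1 * I (fun w => Z w * g w))%:E)%E.
    rewrite -RintegralZl//; last exact: bounded_measurable_integrable.
    rewrite bounded_measurable_EFin_Rintegral; last exact: bounded_measurableZ.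
    by apply: eq_integral => w _; rewrite mulrA.
  rewrite lee_fin ler_pdivrMl// mulr1 /c.
  have : I (fun w => 1 * (Z w * g w) + -1 * (Z w * y w)) <= 0.
    rewrite (_ : (fun _ => _) = fun w => gap y w * (wt w * (g w - y w)))//.
    by apply/funext => w; rewrite /Z; ring.
  by rewrite Rintegral_linear2//; lra.
- have -> : (\int[Q]_w (c^-1 * Z w * X w)%:E =
      (c^-1 * (1 * I (fun w => Z w * y w) + 1 * phi y))%:E)%E.
    rewrite -Rintegral_linear2//; last exact: bounded_gap_sqr.
    have bs : bounded_measurable (fun w => 1 * (Z w * y w) + 1 * gap y w ^+ 2).
      apply: bounded_measurableD; apply: bounded_measurableZ => //.
      exact: bounded_gap_sqr.
    rewrite -RintegralZl//; last exact: bounded_measurable_integrable.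
    rewrite bounded_measurable_EFin_Rintegral; last exact: bounded_measurableZ.
    by apply: eq_integral => w _; congr EFin; rewrite /Z /gap; ring.
  by rewrite lte_fin ltr_pdivlMl// mulr1 /c; lra.
Qed.

End closest_point.

(** * Calculus of quasi-sure relations and representatives *)

Section quasi_sure_calculus.
Context {d : measure_display} {T : measurableType d} {R : realType}.
Variables (Ps : set (probability T R)) (Ps0 : Ps !=set0).
Local Notation L0c := (L0c Ps0).
Implicit Types (X Y : L0c) (C : set L0c).

Lemma qsW (S1 S2 : T -> Prop) : (forall w, S1 w -> S2 w) ->
  qs Ps S1 -> qs Ps S2.
Proof. by move=> S12 S1ae; apply: (qsI Ps0 _ S1ae S1ae) => w /S12. Qed.

(** Each prior is countably subadditive, so countably many polar events can be merged into one. *)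
Lemma qs_forall (S : nat -> T -> Prop) :
  (forall n, qs Ps (S n)) -> qs Ps (fun w => forall n, S n w).
Proof.
move=> qsS; have /choice[N HN] : forall n, exists N, polar_event Ps N /\
    forall w, ~ N w -> S n w by move=> n; have [N] := qsS n; exists N.
exists (\bigcup_n N n) => [|w Nw n]; last first.
  by apply: (HN n).2 => Nnw; apply: Nw; exists n.
have mN n : measurable (N n) by have [[]] := HN n.
split; first exact: bigcup_measurable.
apply/capacity0P => // P PsP; apply: measure_negligible.
  exact: bigcup_measurable.
apply: negligible_bigcup => n; apply/negligibleP => //.
by have [[_ /capacity0P cN] _] := HN n; exact: cN.
Qed.

Lemma qs_ae (mu : {measure set T -> \bar R}) (S : T -> Prop) :
  (forall N, polar_event Ps N -> mu N = 0%E) -> qs Ps S ->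
  {ae mu, forall w, S w}.
Proof.
move=> muPs [N pN NS]; exists N; split; [by case: pN|exact: muPs|].
by move=> w; apply: contra_notP => /NS.
Qed.

Lemma qs_ae_Pc (Q : probability T R) (S : T -> Prop) :
  Pc Ps Q -> qs Ps S -> {ae Q, forall w, S w}.
Proof. exact: qs_ae. Qed.

Lemma subset_Pc : Ps `<=` Pc Ps.
Proof. by move=> P PsP N [_ /capacity0P cN]; exact: cN. Qed.

Lemma qs_integral (mu : {measure set T -> \bar R}) (f g : T -> R) :
  (forall N, polar_event Ps N -> mu N = 0%E) ->
  measurable_fun setT f -> measurable_fun setT g ->
  qs Ps (fun w => f w = g w) ->
  (\int[mu]_w (f w)%:E = \int[mu]_w (g w)%:E)%E.
Proof.
move=> muPs mf mg fg; apply: ae_eq_integral => //; [exact/measurable_EFinP..|].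
by apply: filterS (qs_ae muPs fg) => w /= ->.
Qed.

Lemma measurable_L0c X : measurable_fun setT (X : T -> R).
Proof. by rewrite /L0c_to_fun; exact: measurable_funPT. Qed.

Definition L0c_of (f : T -> R) (mf : measurable_fun setT f) : L0c :=
  L0c_class Ps0 (mfun_Sub (mem_set mf : f \in mfun)).

Lemma L0c_ofE f (mf : measurable_fun setT f) :
  qs Ps (fun w => L0c_of mf w = f w).
Proof. exact: L0c_classE. Qed.

Lemma L0c_leP X Y : (X <= Y) <-> qs Ps (fun w => X w <= Y w).
Proof. by split=> /asboolP. Qed.

Lemma L0c_le_of X Y (f g : T -> R) : qs Ps (fun w => X w = f w) ->
  qs Ps (fun w => Y w = g w) -> (forall w, f w <= g w) -> X <= Y.
Proof.
move=> Xf Yg fg; apply/L0c_leP; apply: (qsI Ps0 _ Xf Yg) => w -> ->.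
exact: fg.
Qed.

Lemma L0c_posP X : L0c_pos X <-> qs Ps (fun w => 0 <= X w).
Proof.
rewrite /L0c_pos/= L0c_leP; split=> h.
  by apply: (qsI Ps0 _ h (L0c_zeroE Ps0)) => w /[swap] ->.
by apply: (qsI Ps0 _ h (L0c_zeroE Ps0)) => w /[swap] ->.
Qed.

Lemma L0c_absE X : qs Ps (fun w => L0c_abs X w = `|X w|).
Proof. exact: L0c_classE. Qed.

Lemma L0c_cstE m : qs Ps (fun w => L0c_cst Ps0 m w = m).
Proof. exact: L0c_classE. Qed.

Lemma L0c_combE X Y a b :
  qs Ps (fun w => (a *: X + b *: Y : L0c) w = a * X w + b * Y w).
Proof.
have h : qs Ps (fun w => (a *: X + b *: Y : L0c) w = a * X w + (b *: Y : L0c) w).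
  by apply: (qsI Ps0 _ (L0c_addE (a *: X) (b *: Y)) (L0c_scaleE a X)) => w -> ->.
by apply: (qsI Ps0 _ h (L0c_scaleE b Y)) => w -> ->.
Qed.

Lemma L0c_subE X Y : qs Ps (fun w => (X - Y : L0c) w = X w - Y w).
Proof.
by apply: (qsI Ps0 _ (L0c_addE X (- Y)) (L0c_oppE Y)) => w -> ->.
Qed.

End quasi_sure_calculus.

(** * Order convergence versus quasi-sure pointwise convergence *)

Section order_convergence.
Context {d : measure_display} {T : measurableType d} {R : realType}.
Variables (Ps : set (probability T R)) (Ps0 : Ps !=set0).
Local Notation L0c := (L0c Ps0).
Implicit Types (X Y : L0c) (C : set L0c).

(** The differences [f - f_ n] serve as dominating sequence. A lower bound of their classes lies,
    outside a single polar event, below all of them at once, hence below their pointwise limit 0. *)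
Lemma cvg_order_cvg (X_ : nat -> L0c) X (f_ : nat -> T -> R) (f : T -> R) :
  (forall n, qs Ps (fun w => X_ n w = f_ n w)) ->
  qs Ps (fun w => X w = f w) ->
  (forall n, measurable_fun setT (f_ n)) -> measurable_fun setT f ->
  (forall w, nondecreasing_seq (f_ ^~ w)) ->
  (forall w, f_ ^~ w @ \oo --> f w) -> order_cvg X_ X.
Proof.
move=> Xf_ Xf mf_ mf ndf f_f.
have f_le n w : f_ n w <= f w.
  rewrite -(cvg_lim _ (f_f w))//.
  by apply: (nondecreasing_cvgn_le (ndf w)); apply/cvg_ex; exists (f w).
have me n : measurable_fun setT (fun w => f w - f_ n w).
  exact: measurable_funB.
exists (fun n => L0c_of Ps0 (me n)); split.
- move=> n p np; apply: (L0c_le_of (L0c_ofE _ _) (L0c_ofE _ _)) => w.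
  by rewrite lerD2l lerN2; exact: ndf.
- split=> [_ [n _ <-]|Z Zlb].
    apply: (L0c_le_of (L0c_zeroE Ps0) (L0c_ofE _ _)) => w.
    by rewrite subr_ge0.
  have Ze : qs Ps (fun w => forall n, (Z : L0c) w <= f w - f_ n w).
    apply: (qs_forall Ps0) => n.
    have /L0c_leP Zn : Z <= L0c_of Ps0 (me n) by apply: Zlb; exists n.
    by apply: (qsI Ps0 _ Zn (L0c_ofE Ps0 (me n))) => w /[swap] ->.
  apply/L0c_leP; apply: (qsI Ps0 _ Ze (L0c_zeroE Ps0)) => w Zw ->.
  have e0 : f w - f_ n w @[n --> \oo] --> (f w - f w : R).
    by apply: cvgB => //; exact: cvg_cst.
  rewrite -[leRHS](subrr (f w)) -(cvg_lim _ e0)//.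
  by apply: limr_ge; [apply/cvg_ex; eexists; exact: e0|exact: nearW].
move=> n; apply/L0c_leP.
have h1 : qs Ps (fun w => (X_ n - X : L0c) w = f_ n w - f w).
  have h : qs Ps (fun w => (X_ n - X : L0c) w = f_ n w - X w).
    by apply: (qsI Ps0 _ (L0c_subE (X_ n) X) (Xf_ n)) => w -> ->.
  by apply: (qsI Ps0 _ h Xf) => w -> ->.
have h2 : qs Ps (fun w => L0c_abs (X_ n - X) w = f w - f_ n w).
  apply: (qsI Ps0 _ (L0c_absE (X_ n - X)) h1) => w -> ->.
  by rewrite distrC ger0_norm// subr_ge0.
by apply: (qsI Ps0 _ h2 (L0c_ofE Ps0 (me n))) => w -> ->.
Qed.

(* The pointwise infimum of the dominating sequence is again a random variable,
   hence a lower bound, and so vanishes quasi-surely. *)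
Lemma order_cvg_qs (X_ : nat -> L0c) X : order_cvg X_ X ->
  qs Ps (fun w => X_ n w @[n --> \oo] --> X w).
Proof.
move=> [Y_ [ndY [lbY glbY] XY]].
(* Quasi-surely [h_ n] is [Y_ n]; the cut at 0 gives a lower bound at every point, so that the
   pointwise infimum is measurable on the whole space. *)
pose h_ n w := Num.max (Y_ n w) 0.
have mh n : measurable_fun setT (h_ n).
  by apply: measurable_maxr => //; exact: measurable_L0c.
have hlb w : has_lbound (range (h_ ^~ w)).
  by exists 0 => _ [n _ <-]; rewrite /h_ le_max lexx orbT.
have mi : measurable_fun setT (fun w => infs (h_ ^~ w) 0).
  exact: measurable_fun_infs.
have Y0 : qs Ps (fun w => forall n, 0 <= Y_ n w).
  apply: (qs_forall Ps0) => n; apply/L0c_posP.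
  by apply: lbY; exists n.
have Ydec : qs Ps (fun w => forall n, Y_ n.+1 w <= Y_ n w).
  by apply: (qs_forall Ps0) => n; apply/L0c_leP; exact: ndY.
have hinf : qs Ps (fun w => infs (h_ ^~ w) 0 <= 0).
  have /L0c_leP H : L0c_of Ps0 mi <= 0.
    apply: glbY => _ [n _ <-]; apply/L0c_leP.
    apply: (qsI Ps0 _ (L0c_ofE Ps0 mi) Y0) => w -> Yw.
    have -> : Y_ n w = h_ n w by rewrite /h_ max_l.
    by apply: ge_inf; [exact/has_lbound_sdrop|exists n].
  have H2 : qs Ps (fun w => infs (h_ ^~ w) 0 <= (0 : L0c) w).
    by apply: (qsI Ps0 _ (L0c_ofE Ps0 mi) H) => w ->.
  by apply: (qsI Ps0 _ H2 (L0c_zeroE Ps0)) => w /[swap] ->.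
have Yd : qs Ps (fun w => forall n, `|X_ n w - X w| <= Y_ n w).
  apply: (qs_forall Ps0) => n; have /L0c_leP h := XY n.
  have h2 : qs Ps (fun w => L0c_abs (X_ n - X) w = `|X_ n w - X w|).
    by apply: (qsI Ps0 _ (L0c_absE (X_ n - X)) (L0c_subE (X_ n) X)) => w -> ->.
  by apply: (qsI Ps0 _ h h2) => w /[swap] ->.
have Yreg : qs Ps (fun w => (forall n, 0 <= Y_ n w) /\
  (forall n, Y_ n.+1 w <= Y_ n w)) by apply: (qsI Ps0 _ Y0 Ydec).
have Yreg2 : qs Ps (fun w => infs (h_ ^~ w) 0 <= 0 /\
  (forall n, `|X_ n w - X w| <= Y_ n w)) by apply: (qsI Ps0 _ hinf Yd).
apply: (qsI Ps0 _ Yreg Yreg2) => w [Y0w Ydw] [infw Ydomw].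
have Ycvg : Y_ n w @[n --> \oo] --> (0 : R).
  apply/cvgrPdist_lt => e e0.
  have hi : has_inf (range (Y_ ^~ w)).
    by split; [exists (Y_ 0%N w), 0%N|exists 0 => _ [n _ <-]].
  have [_ [N _ <-] YNe] := inf_adherent e0 hi.
  have hY : h_ ^~ w = Y_ ^~ w by apply/funext => n; rewrite /h_ max_l.
  have infE : inf (range (Y_ ^~ w)) <= 0.
    by move: infw; rewrite hY /infs/= [sdrop _ _](_ : _ = range (Y_ ^~ w))//;
      apply/seteqP; split=> _ [n _ <-]; exists n.
  exists N => // n /= Nn; rewrite sub0r normrN ger0_norm//.
  have nd : nonincreasing_seq (Y_ ^~ w) by apply/nonincreasing_seqP.
  by apply: le_lt_trans (nd _ _ Nn) _; lra.
apply/cvgrPdist_le => e e0.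
move/cvgrPdist_le : Ycvg => /(_ e e0); apply: filterS => n.
rewrite sub0r normrN ger0_norm// distrC; exact: le_trans.
Qed.

End order_convergence.

(** * From sets of quasi-sure classes to sets of functions *)

Section function_class.
Context {d : measure_display} {T : measurableType d} {R : realType}.
Variables (Ps : set (probability T R)) (Ps0 : Ps !=set0).
Local Notation L0c := (L0c Ps0).
Variable C : set L0c.

(** This is the class [K] of the projection. Membership is insensitive to changes on polar events,
    so sign and order relations can be demanded at every point without losing any positive element
    of [C]. *)
Definition representatives : set (T -> R) := [set f : T -> R |
  [/\ measurable_fun setT f, forall w, 0 <= f w &
      exists2 X, C X & qs Ps (fun w => X w = f w)]].

Lemma representatives_pos X : L0c_pos X -> C X ->
  exists2 f, representatives f & qs Ps (fun w => X w = f w).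
Proof.
move=> /L0c_posP X0 CX; pose f (w : T) : R := Num.max (X w) 0.
have Xf : qs Ps (fun w => X w = f w).
  by apply: qsW X0 => // w Xw; rewrite /f max_l.
exists f => //; split; last by exists X.
- by apply: measurable_maxr => //; exact: measurable_L0c.
- by move=> w; rewrite /f le_max lexx orbT.
Qed.

Lemma representatives_convex (f g : T -> R) (t : R) :
  convex_set (C : set (convex_lmodType L0c)) ->
  representatives f -> representatives g -> 0 <= t -> t <= 1 ->
  representatives (fun w => t * f w + (1 - t) * g w).
Proof.
move=> cC [mf f0 [X CX Xf]] [mg g0 [Y CY Yg]] t0 t1; split.
- by apply: measurable_funD; apply: measurable_funM.
- by move=> w; rewrite addr_ge0// mulr_ge0// subr_ge0.
exists (t *: X + (1 - t) *: Y).
  have := cC X Y (Itv01 t0 t1) (mem_set CX) (mem_set CY).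
  by move/set_mem.
have h : qs Ps (fun w => (t *: X + (1 - t) *: Y : L0c) w =
    t * f w + (1 - t) * Y w).
  by apply: (qsI Ps0 _ (L0c_combE X Y t (1 - t)) Xf) => w -> ->.
by apply: (qsI Ps0 _ h Yg) => w -> ->.
Qed.

Lemma representatives_solid (f g : T -> R) : solid C ->
  representatives f -> measurable_fun setT g ->
  (forall w, 0 <= g w <= f w) -> representatives g.
Proof.
move=> sC [mf f0 [X CX Xf]] mg gf.
split=> //; first by move=> w; have /andP[] := gf w.
exists (L0c_of Ps0 mg); last exact: L0c_ofE.
apply: sC CX _ _.
  apply: (L0c_le_of (L0c_zeroE Ps0) (L0c_ofE _ _)) => w.
  by have /andP[] := gf w.
apply: (L0c_le_of (L0c_ofE _ _) Xf) => w.
by have /andP[] := gf w.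
Qed.

Lemma representatives_nondecreasing_lim (f_ : nat -> T -> R) (f : T -> R) :
  seq_order_closed C -> (forall n, representatives (f_ n)) ->
  (forall w, nondecreasing_seq (f_ ^~ w)) -> measurable_fun setT f ->
  (forall w, f_ ^~ w @ \oo --> f w) -> representatives f.
Proof.
move=> cC Cf_ ndf mf f_f; split=> //.
  move=> w; rewrite -(cvg_lim _ (@f_f w))//; apply: limr_ge.
    by apply/cvg_ex; exists (f w); exact: f_f.
  by apply: nearW => n; have [_ ? _] := Cf_ n.
exists (L0c_of Ps0 mf); last exact: L0c_ofE.
have /choice[X_ HX] n : exists X, C X /\ qs Ps (fun w => X w = f_ n w).
  by have [_ _ [X]] := Cf_ n; exists X.
apply: (cC X_) => [n|]; first exact: (HX n).1.
apply: (@cvg_order_cvg _ _ _ _ _ _ _ f_ f) => //.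
- by move=> n; exact: (HX n).2.
- exact: L0c_ofE.
- by move=> n; have [] := Cf_ n.
Qed.

Lemma jmap_eqP (Q : probability T R) (X Y : L0c) :
  jmap Q X = jmap Q Y <-> {ae Q, forall w, X w = Y w}.
Proof.
have E : (\pi_({mfun_ Q, T >-> R})%qT (repr X) =
    \pi_({mfun_ Q, T >-> R})%qT (repr Y)) <->
    @ae_eq_op _ _ _ T R Q (repr X) (repr Y).
  by split=> [/eqmodP|h]//; exact/eqmodP.
rewrite /jmap E; split=> [/asboolP h|h].
  by apply: filterS h => w; exact.
by apply/asboolP; apply: filterS h => w.
Qed.

(** The structural hypotheses on [C] become those of the projection for [representatives], and the
    resulting weight is bounded everywhere, so its class lies in [Linfc]. *)
Lemma prob_polar_separation (Q : probability T R) (X : L0c) :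
  C !=set0 -> C `<=` @L0c_pos _ _ _ Ps Ps0 ->
  convex_set (C : set (convex_lmodType L0c)) -> solid C ->
  seq_order_closed C -> Pc Ps Q -> L0c_pos X ->
  ~ (jmap Q @` C) (jmap Q X) ->
  exists2 Z : L0c, prob_polar C (Q, Z) &
    (1 < 'E_Q[(Z : T -> R) \* (X : T -> R)])%E.
Proof.
move=> [X0 CX0] Cpos cC sC oC PcQ Xpos nX.
pose x w := Num.max (X w) 0.
have Xx : qs Ps (fun w => X w = x w).
  by move/L0c_posP : Xpos; apply: qsW => // w Xw; rewrite /x max_l.
have mx : measurable_fun setT x.
  by apply: measurable_maxr => //; exact: measurable_L0c.
have x0 w : 0 <= x w by rewrite /x le_max lexx orbT.
have Kne : representatives !=set0.
  by have [f ?] := representatives_pos (Cpos _ CX0) CX0; exists f.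
have := @solid_convex_separation _ _ _ Q representatives x.
case => //.
- by move=> f [].
- by move=> f [].
- by move=> f g t; exact: representatives_convex.
- by move=> f g; exact: representatives_solid.
- by move=> f_ f; exact: representatives_nondecreasing_lim.
(* Equality with [X] under [Q] would put [jmap Q X] into the image of [C]: quasi-sure equalities
   hold [Q]-almost surely because [Q] is in [Pc]. *)
- move=> [f [_ _ [Y CY Yf]] fx]; exfalso; apply: nX; exists Y => //.
  apply/jmap_eqP; near=> w.
  have -> : Y w = f w by near: w; exact: qs_ae_Pc Yf.
  have -> : f w = x w by near: w.
  by apply/esym; near: w; exact: qs_ae_Pc Xx.
move=> [Z [[mZ [M ZM]] Z0 Zpolar ZX]].
have expE (Y : L0c) (f : T -> R) : measurable_fun setT f ->
    qs Ps (fun w => Y w = f w) ->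
    'E_Q[(L0c_of Ps0 mZ : T -> R) \* (Y : T -> R)]%E =
    (\int[Q]_w (Z w * f w)%:E)%E.
  move=> mf Yf; rewrite unlock; apply: (@qs_integral _ _ _ Ps) => //.
  - exact: measurable_funM.
  - by apply: (qsI Ps0 _ Yf (L0c_ofE Ps0 mZ)) => w /= -> ->.
exists (L0c_of Ps0 mZ); last by rewrite (expE _ x).
split=> //=.
- exists (`|M| + 1); first by rewrite ltr_wpDl.
  have absZ : qs Ps (fun w => L0c_abs (L0c_of Ps0 mZ) w = `|Z w|).
    by apply: (qsI Ps0 _ (L0c_absE (L0c_of Ps0 mZ)) (L0c_ofE Ps0 mZ)) => w -> ->.
  apply: (L0c_le_of absZ (L0c_cstE Ps0 _)) => w.
  by rewrite (le_trans (ZM w))// (le_trans (ler_norm M))// lerDl.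
- by apply: (L0c_le_of (L0c_zeroE Ps0) (L0c_ofE _ _)) => w.
- move=> Y CY; have [f Kf Yf] := representatives_pos (Cpos _ CY) CY.
  by rewrite (expE _ f)//; [exact: Zpolar|case: Kf].
Unshelve. all: by end_near. Qed.

End function_class.

(** * Non-negative elements of [ca] and densities *)

Section positive_ca.
Context {d : measure_display} {T : measurableType d} {R : realType}.
Implicit Types (mu nu : ca T R) (A : set T).

(** A charge may take any value off the sigma-algebra; resetting it to 0 there meets the
    normalisation of [ca]. *)
Lemma charge_ca (nu : {charge set T -> \bar R}) :
  exists mu : ca T R, forall A, measurable A -> (mu A)%:E = nu A.
Proof.
pose m A : R^o := if pselect (measurable A) then fine (nu A) else 0.
have mE A : measurable A -> (m A)%:E = nu A.
  move=> mA; rewrite /m; case: (pselect (measurable A)) => // ?.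
  by rewrite fineK// fin_num_measure.
have mP : m \in @ca_pred d T R.
  rewrite inE; split=> [|F mF tF mUF|A nA].
  - by apply: EFin_inj; rewrite mE// charge0.
  - rewrite mE//; under eq_fun do under eq_bigr do rewrite mE//.
    exact: charge_semi_sigma_additive.
  - by rewrite /m; case: (pselect (measurable A)).
by exists (Ca mP).
Qed.

Lemma ca_decomp mu A : measurable A ->
  (mu A)%:E = (ca_jpos mu A - ca_jneg mu A)%E.
Proof.
move=> mA; rewrite -[LHS]/(charge_of_ca mu A).
by rewrite (jordan_decomp (svalP (ca_hahn mu)) mA) /cadd/= cscaleN1.
Qed.

(** The negative part is minus the value of [mu] on a piece of [A], hence non-positive here, while
    being a measure. So it vanishes whichever Hahn decomposition was chosen, and integrals reduce to
    those against one measure. *)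
Lemma ca_jneg_ge0 mu A : (forall B, measurable B -> 0 <= mu B) ->
  measurable A -> ca_jneg mu A = 0%E.
Proof.
move=> mu0 mA; apply/eqP; rewrite eq_le measure_ge0 andbT.
rewrite -[ca_jneg mu A]/(jordan_neg (svalP (ca_hahn mu)) A).
rewrite jordan_negE cjordan_negE /crestr0 mem_set//=.
rewrite lee_fin oppr_le0; apply: mu0; apply: measurableI => //.
by have [_ [mN _] _ _] := svalP (ca_hahn mu).
Qed.

Lemma ca_jpos_ge0 mu A : (forall B, measurable B -> 0 <= mu B) ->
  measurable A -> ca_jpos mu A = (mu A)%:E.
Proof. by move=> pos mA; rewrite ca_decomp// ca_jneg_ge0// sube0. Qed.

Lemma total_variation_ge0 mu A : (forall B, measurable B -> 0 <= mu B) ->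
  measurable A -> Defs.total_variation mu A = (mu A)%:E.
Proof.
move=> mu0 mA; rewrite -[LHS]/(ca_jpos mu A + ca_jneg mu A)%E.
by rewrite ca_jneg_ge0// adde0 ca_jpos_ge0.
Qed.

Lemma ca_integral_ge0E mu (X : T -> R) :
  (forall B, measurable B -> 0 <= mu B) ->
  ca_integral mu X = (\int[ca_jpos mu]_w (X w)%:E)%E.
Proof.
move=> mu0; rewrite /ca_integral.
rewrite [X in (_ - X)%E](eq_measure_integral mzero) => [|A mA _].
  by rewrite integral_measure_zero sube0.
exact: ca_jneg_ge0.
Qed.

Lemma ca_integral_measureE mu (m : {measure set T -> \bar R}) (X : T -> R) :
  (forall A, measurable A -> (mu A)%:E = m A) ->
  ca_integral mu X = (\int[m]_w (X w)%:E)%E.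
Proof.
move=> muE; have mu0 A : measurable A -> 0 <= mu A.
  by move=> mA; rewrite -lee_fin muE.
rewrite ca_integral_ge0E//; apply: eq_measure_integral => A mA _.
exact: etrans (ca_jpos_ge0 mu0 mA) (muE A mA).
Qed.

(** The values of [m] make it dominated by [Q], and uniqueness identifies its Radon-Nikodym
    derivative with [Z] almost surely; the change of variables formula then applies. *)
Lemma integral_density (Q : probability T R)
    (m : {finite_measure set T -> \bar R}) (Z f : T -> R) :
  bounded_measurable Z -> (forall w, 0 <= Z w) ->
  (forall A, measurable A -> m A = (\int[Q]_(w in A) (Z w)%:E)%E) ->
  measurable_fun setT f -> (forall w, 0 <= f w) ->
  (\int[m]_w (f w)%:E = \int[Q]_w (Z w * f w)%:E)%E.
Proof.
move=> bZ Z0 mZ mf f0.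
have mQ : m `<< Q.
  apply/null_content_dominatesP => A mA QA; rewrite mZ//.
  rewrite (_ : \int[Q]_(w in A) _ = \int[Q]_(w in A) `|(Z w)%:E|)%E.
    apply: integral_abs_eq0 => //.
    by apply/measurable_EFinP/measurable_funTS; case: bZ.
  by apply: eq_integral => w _; rewrite gee0_abs ?lee_fin.
have aeZ : ae_eq Q setT (EFin \o Z) (Radon_Nikodym_SigmaFinite.f m Q).
  apply: integral_ae_eq => //.
  - exact: bounded_measurable_integrable.
  - exact: measurable_int (Radon_Nikodym_SigmaFinite.f_integrable mQ).
  - move=> A _ mA; rewrite -Radon_Nikodym_SigmaFinite.f_integral//.
    by rewrite mZ.
have mRN : measurable_fun setT (Radon_Nikodym_SigmaFinite.f m Q).
  exact: measurable_int (Radon_Nikodym_SigmaFinite.f_integrable mQ).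
have f0' w : (0 <= (f w)%:E)%E by rewrite lee_fin.
have mf' : measurable_fun setT (fun w => (f w)%:E) by exact/measurable_EFinP.
rewrite -(Radon_Nikodym_SigmaFinite.change_of_variables mQ f0' measurableT mf').
apply: ae_eq_integral => //.
- by apply: emeasurable_funM => //; exact/measurable_EFinP.
- by apply/measurable_EFinP/measurable_funM => //; case: bZ.
apply: filterS aeZ => w /= h Tw; rewrite -h//.
by rewrite -EFinM mulrC.
Qed.

Lemma density_ca (Q : probability T R) (Z : T -> R) :
  bounded_measurable Z -> (forall w, 0 <= Z w) ->
  exists mu : ca T R, [/\ forall A, measurable A -> 0 <= mu A,
    forall A, measurable A -> (mu A)%:E = (\int[Q]_(w in A) (Z w)%:E)%E &
    forall f : T -> R, measurable_fun setT f -> (forall w, 0 <= f w) ->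
      ca_integral mu f = (\int[Q]_w (Z w * f w)%:E)%E].
Proof.
move=> bZ Z0.
have [mu muE] := charge_ca (induced_charge
  (bounded_measurable_integrable Q bZ)).
have mu0 A : measurable A -> 0 <= mu A.
  move=> mA; rewrite -lee_fin muE//; apply: integral_ge0 => w _.
  by rewrite lee_fin.
exists mu; split=> // f mf f0.
rewrite ca_integral_ge0E//; apply: integral_density => // A mA.
exact: etrans (ca_jpos_ge0 mu0 mA) (muE A mA).
Qed.

End positive_ca.

(** * Absolute continuity with respect to the priors, and supports *)

Section ca_c.
Context {d : measure_display} {T : measurableType d} {R : realType}.
Variables (Ps : set (probability T R)) (Ps0 : Ps !=set0).
Local Notation L0c := (L0c Ps0).
Implicit Types (mu nu : ca T R) (X : L0c) (C : set L0c).

Lemma cac_posP mu : cac_pos Ps mu <->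
  (forall A, measurable A -> 0 <= mu A) /\
  (forall N, polar_event Ps N -> mu N = 0).
Proof.
split=> [[muc mu0]|[mu0 muc]]; split=> // N pN; have [mN _] := pN.
  by apply: EFin_inj; rewrite -total_variation_ge0//; exact: muc.
by rewrite total_variation_ge0// muc.
Qed.

Lemma cac_pos_jpos mu N : cac_pos Ps mu -> polar_event Ps N ->
  ca_jpos mu N = 0%E.
Proof.
move=> /cac_posP[mu0 muc] pN; have [mN _] := pN.
by rewrite ca_jpos_ge0// muc.
Qed.

Lemma cac_jordan mu N : cac Ps mu -> polar_event Ps N ->
  ca_jpos mu N = 0%E /\ ca_jneg mu N = 0%E.
Proof.
move=> muc pN; have := muc _ pN.
rewrite -[Defs.total_variation mu N]/(ca_jpos mu N + ca_jneg mu N)%E.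
by move/eqP; rewrite padde_eq0// => /andP[/eqP -> /eqP ->].
Qed.

Lemma qs_ca_integral mu (f g : T -> R) : cac Ps mu ->
  measurable_fun setT f -> measurable_fun setT g ->
  qs Ps (fun w => f w = g w) -> ca_integral mu f = ca_integral mu g.
Proof.
move=> muc mf mg fg; congr (_ - _)%E;
  by apply: (qs_integral _ mf mg fg) => N /(cac_jordan muc)[].
Qed.

Lemma eq_supported (m1 m2 : set T -> \bar R) :
  (forall A, measurable A -> m1 A = m2 A) ->
  supported Ps m1 -> supported Ps m2.
Proof.
move=> m12 [S [mS Sc0 SN]]; exists S; split=> // [|N mN].
  by rewrite -m12//; exact: measurableC.
by rewrite -m12; [exact: SN|exact: measurableI].
Qed.

(** If S supports [Q], then S intersected with {Z != 0} supports the density: on a null part of it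
    [Z] vanishes [Q]-almost everywhere though it is nowhere 0 there, so that part is [Q]-null and
    lies in S, hence is polar. *)
Lemma supported_density (Q m : {measure set T -> \bar R}) (Z : T -> R) :
  measurable_fun setT Z -> (forall w, 0 <= Z w) ->
  (forall A, measurable A -> m A = (\int[Q]_(w in A) (Z w)%:E)%E) ->
  supported Ps Q -> supported Ps m.
Proof.
move=> mZ Z0 mE [S [mS QSc SN]].
pose P := [set w | Z w != 0].
have mP : measurable P.
  rewrite (_ : P = ~` (Z @^-1` [set 0])).
    by apply: measurableC; rewrite -[X in measurable X]setTI; exact: mZ.
  by apply/seteqP; split=> w /eqP.
have mSP : measurable (S `&` P) by exact: measurableI.
have absZ A : (\int[Q]_(w in A) (Z w)%:E = \int[Q]_(w in A) `|(Z w)%:E|)%E.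
  by apply: eq_integral => w _; rewrite gee0_abs ?lee_fin.
have mZA A : measurable_fun A (fun w => (Z w)%:E).
  exact/measurable_EFinP/measurable_funTS.
exists (S `&` P); split=> // [|N mN].
  rewrite setCI; apply: null_set_setU; [exact: measurableC..| |].
    rewrite -[LHS]/(m (~` S)) mE; last exact: measurableC.
    by rewrite absZ integral_abs_eq0//; exact: measurableC.
  rewrite -[LHS]/(m (~` P)) mE; last exact: measurableC.
  by apply: integral0_eq => w /negP; rewrite negbK => /eqP ->.
have mNSP : measurable (N `&` (S `&` P)) by exact: measurableI.
rewrite mE// absZ => /(ae_eq_integral_abs Q mNSP (mZA _)) Z_ae0.
have E : N `&` (S `&` P) = N `&` P `&` S by rewrite (setIC S) setIA.
rewrite E; apply: SN; first exact: measurableI.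
rewrite -E; apply: measure_negligible => //.
apply: negligibleS Z_ae0 => w [Nw [Sw Pw]] /= /(_ (conj Nw (conj Sw Pw))).
by move=> [Zw0]; move: Pw; rewrite /P/= Zw0 eqxx.
Qed.

End ca_c.

(** * Translation between pairs and measures; closure properties of the bipolar *)

Section bipolars.
Context {d : measure_display} {T : measurableType d} {R : realType}.
Variables (Ps : set (probability T R)) (Ps0 : Ps !=set0).
Local Notation L0c := (L0c Ps0).
Implicit Types (mu nu : ca T R) (X Y Z : L0c) (C : set L0c)
  (Q : probability T R).

Lemma L0c_pos_representative X : L0c_pos X ->
  exists x : T -> R, [/\ measurable_fun setT x, forall w, 0 <= x w &
    qs Ps (fun w => X w = x w)].
Proof.
move=> Xpos; have [x [mx x0 _] Xx] :=
  @representatives_pos _ _ _ _ Ps0 setT X Xpos I.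
by exists x.
Qed.

Lemma Linfc_pos_representative Z : Linfc Z -> L0c_pos Z ->
  exists z : T -> R, [/\ bounded_measurable z, forall w, 0 <= z w &
    qs Ps (fun w => Z w = z w)].
Proof.
move=> [m m0 /L0c_leP Zm] /L0c_pos_representative[x [mx x0 Zx]].
have Zm' : qs Ps (fun w => `|Z w| <= m).
  have h := qsI Ps0 (fun w a b => conj a b) (L0c_absE Z) (L0c_cstE Ps0 m).
  by apply: (qsI Ps0 _ Zm h) => w + [e1 e2]; rewrite e1 e2.
exists (fun w => Num.min (x w) m); split.
- split; first exact: measurable_minr.
  exists m => w; rewrite ger0_norm ?ge_min ?lexx ?orbT// le_min x0.
  exact: ltW.
- by move=> w; rewrite le_min x0 ltW.
- apply: (qsI Ps0 _ Zx Zm') => w -> xm; rewrite min_l//.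
  exact: le_trans (ler_norm _) xm.
Qed.

Lemma expectationE Q X Z (x z : T -> R) : Pc Ps Q ->
  measurable_fun setT x -> measurable_fun setT z ->
  qs Ps (fun w => X w = x w) -> qs Ps (fun w => Z w = z w) ->
  'E_Q[(Z : T -> R) \* (X : T -> R)]%E = (\int[Q]_w (z w * x w)%:E)%E.
Proof.
move=> PcQ mx mz Xx Zz; rewrite unlock; apply: (@qs_integral _ _ _ Ps) => //.
- exact: measurable_funM.
- by apply: (qsI Ps0 _ Xx Zz) => w /= -> ->.
Qed.

Lemma prob_density_cac_pos Q Z : Pc Ps Q -> Linfc Z -> L0c_pos Z ->
  exists mu, [/\ cac_pos Ps mu, (supported Ps Q -> scac_pos Ps mu) &
    forall X, L0c_pos X ->
      ca_integral mu X = 'E_Q[(Z : T -> R) \* (X : T -> R)]%E].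
Proof.
move=> PcQ Zb Zpos.
have [z [bz z0 Zz]] := Linfc_pos_representative Zb Zpos.
have mz : measurable_fun setT z by case: bz.
have [mu [mu0 muE muint]] := density_ca Q bz z0.
have muc : cac_pos Ps mu.
  apply/cac_posP; split=> // N pN; have [mN _] := pN.
  apply: EFin_inj; rewrite muE//.
  rewrite (eq_integral (fun w => `|(z w)%:E|%E)) => [|w _].
    apply: integral_abs_eq0 => //; last exact: PcQ.
    by apply/measurable_EFinP; exact: measurable_funTS.
  by rewrite gee0_abs// lee_fin.
exists mu; split=> // [suppQ|X /L0c_pos_representative[x [mx x0 Xx]]].
  split=> //; split; first by case: muc.
  have suppmu : supported Ps (ca_jpos mu).
    apply: (supported_density mz z0 _ suppQ) => A mA.
    by rewrite -muE//; exact: ca_jpos_ge0.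
  apply: eq_supported suppmu => A mA.
  by rewrite total_variation_ge0//; exact: ca_jpos_ge0.
rewrite (expectationE PcQ mx mz Xx Zz) -muint//.
by apply: (@qs_ca_integral _ _ _ Ps) => //; case: muc.
Qed.

(** The pair is the normalised measure together with its total mass as a constant density. For the
    zero measure normalisation falls back on a prior [P0], which is in [Pc], and the density is then
    0. *)
Lemma cac_pos_prob_density mu : cac_pos Ps mu ->
  exists Q Z, [/\ Pc Ps Q, Linfc Z, L0c_pos Z &
    forall X, L0c_pos X ->
      'E_Q[(Z : T -> R) \* (X : T -> R)]%E = ca_integral mu X].
Proof.
move=> muc; have [mu0 muPs] := (cac_posP Ps mu).1 muc.
have [P0 PsP0] := Ps0.
pose c := mu setT.
have c0 : 0 <= c by exact: mu0.
pose Q : probability T R := mnormalize (ca_jpos mu) P0.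
have QE A : Q A = if c == 0 then P0 A else (ca_jpos mu A * c^-1%:E)%E.
  rewrite -[LHS]/(mnormalize (ca_jpos mu) P0 A) /mnormalize.
  have -> : (ca_jpos mu : {measure set T -> \bar R}) setT = c%:E.
    exact: ca_jpos_ge0.
  by rewrite eqe orbF; case: ifPn.
have cQ A : measurable A -> ca_jpos mu A = (c%:E * Q A)%E.
  move=> mA; rewrite QE; have [c00|cN0] := eqVneq c 0.
    rewrite c00 mul0e; apply/eqP; rewrite -measure_le0 -[leRHS]/(0%:E) -c00.
    by rewrite -[c%:E]ca_jpos_ge0// le_measure// inE.
  by rewrite muleCA -EFinM divff// mule1.
have PcQ : Pc Ps Q.
  move=> N pN; rewrite QE; case: ifPn => _; first exact: subset_Pc pN.
  by rewrite (cac_pos_jpos muc pN) mul0e.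
have mc : measurable_fun setT (cst c : T -> R) by [].
exists Q, (L0c_of Ps0 mc); split=> //.
- exists (c + 1); first by rewrite ltr_wpDl.
  have absc : qs Ps (fun w => L0c_abs (L0c_of Ps0 mc) w = c).
    apply: (qsI Ps0 _ (L0c_absE (L0c_of Ps0 mc)) (L0c_ofE Ps0 mc)) => w -> ->.
    by rewrite ger0_norm.
  by apply: (L0c_le_of absc (L0c_cstE Ps0 _)) => w; rewrite lerDl.
- by apply: (L0c_le_of (L0c_zeroE Ps0) (L0c_ofE _ _)).
move=> X /L0c_pos_representative[x [mx x0 Xx]].
rewrite (expectationE PcQ mx mc Xx (L0c_ofE Ps0 mc)).
rewrite (@qs_ca_integral _ _ _ Ps _ X x)//; last by case: muc.
have mx' : measurable_fun setT (fun w => (x w)%:E) by exact/measurable_EFinP.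
have x0' w : setT w -> (0 <= (x w)%:E)%E by rewrite lee_fin.
transitivity (\int[mscale (NngNum c0) Q]_w (x w)%:E)%E.
  by rewrite ge0_integral_mscale// -ge0_integralZl.
rewrite ca_integral_ge0E//; apply: eq_measure_integral => A mA _.
exact/esym/cQ.
Qed.

(** Both translations preserve integrals of positive elements, so they carry the constraints of
    either polar to the other and the two bipolars impose the same inequalities on [X]. *)
Lemma measure_bipolar_cac C : C `<=` @L0c_pos _ _ _ Ps Ps0 ->
  measure_bipolar (cac_pos Ps) C = prob_bipolar C.
Proof.
move=> Cpos; apply/seteqP; split=> X [Xpos Xbip]; split=> //.
  move=> [Q Z] [/= PcQ Zb Zpos Zpol].
  have [mu [muc _ muE]] := prob_density_cac_pos PcQ Zb Zpos.
  rewrite -muE//; apply: Xbip; split=> // Y CY.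
  by rewrite muE; [exact: Zpol|exact: Cpos].
move=> mu [muc mupol].
have [Q [Z [PcQ Zb Zpos muE]]] := cac_pos_prob_density muc.
rewrite -muE//; apply: (Xbip (Q, Z)); split=> //= Y CY.
by rewrite muE; [exact: mupol|exact: Cpos].
Qed.

Lemma prob_bipolar_convex C :
  convex_set (prob_bipolar C : set (convex_lmodType L0c)).
Proof.
move=> X Y l /set_mem[Xpos Xbip] /set_mem[Ypos Ybip].
have [x [mx x0 Xx]] := L0c_pos_representative Xpos.
have [y [my y0 Yy]] := L0c_pos_representative Ypos.
pose t : R := l%:num; have t0 : 0 <= t by rewrite /t.
have t1 : 0 <= 1 - t by rewrite subr_ge0 /t.
have combE : qs Ps (fun w => (t *: X + (1 - t) *: Y : L0c) w =
    t * x w + (1 - t) * y w).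
  have h := qsI Ps0 (fun w a b => conj a b) Xx Yy.
  by apply: (qsI Ps0 _ (L0c_combE X Y t (1 - t)) h) => w -> [-> ->].
suff : prob_bipolar C (t *: X + (1 - t) *: Y) by exact: mem_set.
have mcomb : measurable_fun setT (fun w => t * x w + (1 - t) * y w).
  by apply: measurable_funD; exact: measurable_funM.
split.
  apply: (L0c_le_of (L0c_zeroE Ps0) combE) => w.
  by rewrite addr_ge0// mulr_ge0.
move=> [Q Z] QZ; have [/= PcQ Zb Zpos _] := QZ.
have [z [[mz _] z0 Zz]] := Linfc_pos_representative Zb Zpos.
rewrite (expectationE PcQ mcomb mz combE Zz).
under eq_integral => w _ do
  rewrite mulrDr !(mulrCA (z w)) EFinD !EFinM.
have mzf (f : T -> R) : measurable_fun setT f ->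
    measurable_fun setT (fun w => ((z w)%:E * (f w)%:E)%E).
  by move=> mf; apply: emeasurable_funM; exact/measurable_EFinP.
have zf0 (f : T -> R) w : 0 <= f w -> (0 <= (z w)%:E * (f w)%:E)%E.
  by move=> fw; rewrite mule_ge0// lee_fin.
have zx0 w : setT w -> (0 <= (z w)%:E * (x w)%:E)%E by move=> _; exact: zf0.
have zy0 w : setT w -> (0 <= (z w)%:E * (y w)%:E)%E by move=> _; exact: zf0.
have mzx := mzf _ mx; have mzy := mzf _ my.
have mcM (c : R) g : measurable_fun setT g ->
    measurable_fun setT (fun w : T => (c%:E * g w)%E).
  by move=> mg; exact: emeasurable_funM.
rewrite ge0_integralD//; last 4 first.
- by move=> w Tw; apply: mule_ge0; [rewrite lee_fin|exact: zx0].
- exact: mcM.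
- by move=> w Tw; apply: mule_ge0; [rewrite lee_fin|exact: zy0].
- exact: mcM.
rewrite !ge0_integralZl//.
have := Xbip _ QZ; rewrite (expectationE PcQ mx mz Xx Zz) => Xle.
have := Ybip _ QZ; rewrite (expectationE PcQ my mz Yy Zz) => Yle.
apply: (@le_trans _ _ (t%:E * 1 + (1 - t)%:E * 1)%E); last first.
  by rewrite !mule1 -EFinD lee_fin; lra.
apply: leeD; apply: lee_wpmul2l; rewrite ?lee_fin//.
Qed.

Lemma prob_bipolar_solid C : solid (prob_bipolar C).
Proof.
move=> X Y [Xpos Xbip] Ypos /L0c_leP YX; split=> // -[Q Z] QZ.
have [/= PcQ Zb Zpos _] := QZ.
have [x [mx x0 Xx]] := L0c_pos_representative Xpos.
have [y [my y0 Yy]] := L0c_pos_representative Ypos.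
have [z [[mz _] z0 Zz]] := Linfc_pos_representative Zb Zpos.
(* The order between Y and X is only quasi-sure; the minimum is a representative of Y dominated by x
   at every point. *)
have Yxy : qs Ps (fun w => (Y : L0c) w = Num.min (y w) (x w)).
  have h := qsI Ps0 (fun w a b => conj a b) Xx Yy.
  by apply: (qsI Ps0 _ YX h) => w yx [ex ey]; rewrite ey min_l// -ex -ey.
have mmin : measurable_fun setT (fun w => Num.min (y w) (x w)).
  exact: measurable_minr.
rewrite (expectationE PcQ mmin mz Yxy Zz).
apply: le_trans (Xbip _ QZ); rewrite (expectationE PcQ mx mz Xx Zz).
apply: ge0_le_integral => //.
- by move=> w _; rewrite lee_fin mulr_ge0// le_min y0 x0.
- by apply/measurable_EFinP; exact: measurable_funM.
- by apply/measurable_EFinP; exact: measurable_funM.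
- by move=> w _; rewrite lee_fin ler_wpM2l// ge_min lexx orbT.
Qed.

(** Order convergence gives quasi-sure convergence, and the bound 1 passes to the limit by Fatou's
    lemma under each [Q]. *)
Lemma prob_bipolar_seq_order_closed C : seq_order_closed (prob_bipolar C).
Proof.
move=> X_ X bipX_ /order_cvg_qs X_X.
have Xpos : L0c_pos X.
  apply/L0c_posP.
  have X_pos : qs Ps (fun w => forall n, 0 <= X_ n w).
    by apply: (qs_forall Ps0) => n; apply/L0c_posP; case: (bipX_ n).
  apply: (qsI Ps0 _ X_X X_pos) => w cw X_w0.
  rewrite -(cvg_lim _ cw)//; apply: limr_ge; last exact: nearW.
  by apply/cvg_ex; exists (X w).
split=> // -[Q Z] QZ; have [/= PcQ Zb Zpos _] := QZ.
have /choice[x_ Hx_] n := L0c_pos_representative (proj1 (bipX_ n)).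
have [x [mx x0 Xx]] := L0c_pos_representative Xpos.
have [z [[mz _] z0 Zz]] := Linfc_pos_representative Zb Zpos.
have [N [mN pN] NE] : qs Ps (fun w => x_ n w @[n --> \oo] --> x w).
  have h : qs Ps (fun w => forall n, X_ n w = x_ n w).
    by apply: (qs_forall Ps0) => n; have [] := Hx_ n.
  have h2 : qs Ps (fun w => X_ n w @[n --> \oo] --> x w).
    by apply: (qsI Ps0 _ X_X Xx) => w /[swap] ->.
  apply: (qsI Ps0 _ h2 h) => w /[swap] hw.
  by rewrite (_ : X_ ^~ w = x_ ^~ w)//; apply/funext => n.
(* Killing the exceptional polar set makes the convergence hold everywhere. *)
pose ind w : R := \1_(~` N) w.
have mind : measurable_fun setT ind.
  by apply: measurable_indic; exact: measurableC.
have ind0 w : 0 <= ind w by [].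
have qsind : qs Ps (fun w => ind w = 1).
  by exists N => // w Nw; rewrite /ind indicE mem_set.
have ind_cvg w : x_ n w * ind w @[n --> \oo] --> (x w * ind w : R).
  have [Nw|Nw] := pselect (N w).
    rewrite /ind indicE memNset//= mulr0.
    by under eq_fun do rewrite mulr0; exact: cvg_cst.
  apply: cvgM; [exact: NE|exact: cvg_cst].
have mzx n : measurable_fun setT (fun w => z w * (x_ n w * ind w)).
  by apply: measurable_funM => //; apply: measurable_funM => //; case: (Hx_ n).
have Xn_le n : (\int[Q]_w (z w * (x_ n w * ind w))%:E <= 1)%E.
  have [mxn xn0 Xxn] := Hx_ n.
  have mxi : measurable_fun setT (fun w => x_ n w * ind w).
    exact: measurable_funM.
  have Xxi : qs Ps (fun w => X_ n w = x_ n w * ind w).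
    by apply: (qsI Ps0 _ Xxn qsind) => w -> ->; rewrite mulr1.
  by rewrite -(expectationE PcQ mxi mz Xxi Zz); exact: (bipX_ n).2 _ QZ.
have mxi : measurable_fun setT (fun w => x w * ind w).
  exact: measurable_funM.
have Xxi : qs Ps (fun w => X w = x w * ind w).
  by apply: (qsI Ps0 _ Xx qsind) => w -> ->; rewrite mulr1.
rewrite (expectationE PcQ mxi mz Xxi Zz).
have limE w : (z w * (x w * ind w))%:E =
    limn_einf (fun n => (z w * (x_ n w * ind w))%:E).
  apply/esym; apply: (cvg_limn_einf_sup _).1.
  apply: cvg_EFin; first exact: nearW.
  by apply: cvgM; [exact: cvg_cst|exact: ind_cvg].
under eq_integral do rewrite limE.
apply: le_trans (fatou Q measurableT _ _) _.
- by move=> n; apply/measurable_EFinP.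
- by move=> n w _; rewrite lee_fin !mulr_ge0//; have [_ ->] := Hx_ n.
rewrite limn_einf_lim; apply: lime_le.
  exact/ereal_nondecreasing_is_cvgn/nondecreasing_einfs.
apply: nearW => n; apply: le_trans (Xn_le n).
by apply: ereal_inf_lbound; exists n => /=.
Qed.

(** Every defining inequality involves a single [Q], so it can be read off an element of the bipolar
    that agrees with X under that [Q]. Positivity is tested under each prior separately, all priors
    being in [Pc]. *)
Lemma prob_bipolar_sensitive C : Pc_sensitive (prob_bipolar C).
Proof.
apply/seteqP; split=> [X bX Q PcQ|X sX]; first by exists X.
have Xpos : L0c_pos X.
  apply/L0c_posP.
  have mneg : measurable [set w | ~ (0 <= X w)].
    rewrite (_ : [set w | _] = ~` (X @^-1` `[0, +oo[)).
      apply: measurableC; rewrite -[X in measurable X]setTI.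
      by apply: measurable_L0c => //; exact: measurable_itv.
    by apply/seteqP; split=> w /=; rewrite in_itv/= andbT.
  exists [set w | ~ (0 <= X w)]; last by move=> w /contrapT.
  split=> //; apply/capacity0P => // P PsP.
  have [Y [Ypos _] /jmap_eqP YX] := sX P (subset_Pc Ps0 PsP).
  apply: measure_negligible => //.
  move/L0c_posP : Ypos => /(qs_ae_Pc (subset_Pc Ps0 PsP)) Yae.
  have : {ae P, forall w, 0 <= X w}.
    by apply: filterS2 YX Yae => w ->.
  by [].
split=> // -[Q Z] QZ; have [/= PcQ Zb Zpos _] := QZ.
have [Y [Ypos Ybip] /jmap_eqP YX] := sX Q PcQ.
apply: le_trans (Ybip _ QZ) => /=.
rewrite unlock le_eqVlt; apply/orP; left; apply/eqP.
apply: ae_eq_integral => //.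
- by apply/measurable_EFinP; apply: measurable_funM; exact: measurable_L0c.
- by apply/measurable_EFinP; apply: measurable_funM; exact: measurable_L0c.
by apply: filterS YX => w /= ->.
Qed.

End bipolars.

(** * Convexity, solidity and weak closedness of the measure polars *)

Section measure_polars.
Context {d : measure_display} {T : measurableType d} {R : realType}.
Variables (Ps : set (probability T R)) (Ps0 : Ps !=set0).
Local Notation L0c := (L0c Ps0).
Implicit Types (mu nu : ca T R) (X : L0c) (C : set L0c).

Lemma cac_pos_comb mu nu (s t : R) : 0 <= s -> 0 <= t ->
  cac_pos Ps mu -> cac_pos Ps nu -> cac_pos Ps (s *: mu + t *: nu).
Proof.
move=> s0 t0 /cac_posP[mu0 muN] /cac_posP[nu0 nuN]; apply/cac_posP; split.
  by move=> A mA; rewrite addr_ge0// mulr_ge0 ?mu0 ?nu0.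
move=> N pN; rewrite -[LHS]/(s * mu N + t * nu N).
by rewrite muN// nuN// !mulr0 addr0.
Qed.

(** The Hahn decomposition chosen for the combination is unrelated to those of [mu] and [nu]; the
    identity is therefore obtained from the values on events, which determine the integral of a
    non-negative element. *)
Lemma ca_integral_comb mu nu (s t : R) (x : T -> R) : 0 <= s -> 0 <= t ->
  cac_pos Ps mu -> cac_pos Ps nu ->
  measurable_fun setT x -> (forall w, 0 <= x w) ->
  (ca_integral (s *: mu + t *: nu)%R x =
   s%:E * ca_integral mu x + t%:E * ca_integral nu x)%E.
Proof.
move=> s0 t0 muc nuc mx x0.
have [mu0 _] := (cac_posP Ps mu).1 muc; have [nu0 _] := (cac_posP Ps nu).1 nuc.
have mx' : measurable_fun setT (fun w => (x w)%:E) by exact/measurable_EFinP.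
have x0' w : setT w -> (0 <= (x w)%:E)%E by rewrite lee_fin.
pose m1 : {measure set T -> \bar R} := mscale (NngNum s0) (ca_jpos mu).
pose m2 : {measure set T -> \bar R} := mscale (NngNum t0) (ca_jpos nu).
rewrite (ca_integral_measureE (m := measure_add m1 m2)) => [|A mA].
  rewrite ge0_integral_measure_add// !ge0_integral_mscale//.
  by rewrite !ca_integral_ge0E.
transitivity (m1 A + m2 A)%E; last exact/esym/measure_addE.
have -> : m1 A = (s * mu A)%:E by rewrite EFinM -ca_jpos_ge0.
have -> : m2 A = (t * nu A)%:E by rewrite EFinM -ca_jpos_ge0.
by [].
Qed.

(** The union of the two supports works: with both coefficients positive, an event null for the
    combination is null for each summand, so its traces on the two supports are polar. *)
Lemma scac_comb mu nu (s t : R) : 0 < s -> 0 < t ->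
  scac_pos Ps mu -> scac_pos Ps nu -> scac_pos Ps (s *: mu + t *: nu).
Proof.
move=> s0 t0 [[_ smu] muc] [[_ snu] nuc].
have cpos := cac_pos_comb (ltW s0) (ltW t0) muc nuc.
split=> //; split; first by case: cpos.
have [mu0 _] := (cac_posP Ps mu).1 muc; have [nu0 _] := (cac_posP Ps nu).1 nuc.
have [c0 _] := (cac_posP Ps _).1 cpos.
have [S [mS muSc muS]] := smu; have [S' [mS' nuSc nuS]] := snu.
have mSc := measurableC mS; have mSc' := measurableC mS'.
have tvE A : measurable A -> Defs.total_variation (s *: mu + t *: nu) A =
    (s%:E * Defs.total_variation mu A + t%:E * Defs.total_variation nu A)%E.
  by move=> mA; rewrite !total_variation_ge0.
exists (S `|` S'); split; first exact: measurableU.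
- rewrite setCU tvE; last exact: measurableI.
  rewrite (subset_measure0 _ mSc _ muSc)//; last exact: measurableI.
  rewrite (subset_measure0 _ mSc' _ nuSc)//; last exact: measurableI.
  by rewrite !mule0 adde0.
move=> N mN; have mNS : measurable (N `&` (S `|` S')).
  by apply: measurableI => //; exact: measurableU.
rewrite tvE// => /eqP; rewrite padde_eq0; last 2 first.
- by rewrite mule_ge0// lee_fin ltW.
- by rewrite mule_ge0// lee_fin ltW.
rewrite !mule_eq0 !eqe (gt_eqF s0) (gt_eqF t0)/= => /andP[/eqP muN /eqP nuN].
have [mNS1 pN1] : polar_event Ps (N `&` S).
  apply: muS => //; apply: (subset_measure0 _ mNS _ muN) => //.
    exact: measurableI.
  by rewrite setIUr.
have [mNS2 pN2] : polar_event Ps (N `&` S').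
  apply: nuS => //; apply: (subset_measure0 _ mNS _ nuN) => //.
    exact: measurableI.
  by rewrite setIUr.
split=> //; apply/capacity0P => // P PsP; rewrite setIUr.
move/capacity0P : pN1 => pN1; move/capacity0P : pN2 => pN2.
by apply: null_set_setU => //; [exact: pN1|exact: pN2].
Qed.

Lemma measure_polar_convex (M : set (ca T R)) C :
  C `<=` @L0c_pos _ _ _ Ps Ps0 -> M `<=` cac_pos Ps ->
  (forall mu nu (s t : R), 0 < s -> 0 < t -> M mu -> M nu ->
    M (s *: mu + t *: nu)) ->
  convex_set (measure_polar M C : set (convex_lmodType (ca T R))).
Proof.
(* Only weights strictly between 0 and 1 remain to be checked, in accordance with the strict
   inequalities in [Mcomb]. *)
move=> Cpos Mpos Mcomb; apply/convex_setW => mu nu /set_mem[Mmu mupol].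
move=> /set_mem[Mnu nupol] l l0 l1.
have l1' : 0 < 1 - l%:num by rewrite subr_gt0.
suff : measure_polar M C
    (l%:num *: (mu : ca T R) + (1 - l%:num) *: (nu : ca T R)).
  exact: mem_set.
split=> [|X CX]; first exact: Mcomb.
have [x [mx x0 Xx]] := L0c_pos_representative (Cpos _ CX).
have eqx mu' : cac_pos Ps mu' -> ca_integral mu' X = ca_integral mu' x.
  by move=> [muc _]; apply: (@qs_ca_integral _ _ _ Ps).
rewrite eqx; last exact/Mpos/Mcomb.
rewrite (ca_integral_comb (ltW l0) (ltW l1'))//; [|exact: Mpos..].
rewrite -!eqx; [|exact: Mpos..].
apply: (@le_trans _ _ (l%:num%:E * 1 + (1 - l%:num)%:E * 1)%E); last first.
  by rewrite !mule1 -EFinD lee_fin; lra.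
apply: leeD; apply: lee_wpmul2l; rewrite ?lee_fin ?(ltW l0) ?(ltW l1')//.
  exact: mupol.
exact: nupol.
Qed.

Lemma measure_polar_solid (M : set (ca T R)) C :
  C `<=` @L0c_pos _ _ _ Ps Ps0 -> M `<=` cac_pos Ps ->
  solid_in M (measure_polar M C).
Proof.
move=> Cpos Mpos mu nu [Mmu mupol] Mnu numu; split=> // X CX.
have [x [mx x0 Xx]] := L0c_pos_representative (Cpos _ CX).
have eqx mu' : cac_pos Ps mu' -> ca_integral mu' X = ca_integral mu' x.
  by move=> [muc _]; apply: (@qs_ca_integral _ _ _ Ps).
apply: le_trans (mupol _ CX); rewrite !eqx; [|exact: Mpos..].
have [mu0 _] := (cac_posP Ps mu).1 (Mpos _ Mmu).
have [nu0 _] := (cac_posP Ps nu).1 (Mpos _ Mnu).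
rewrite !ca_integral_ge0E//; apply: ge0_le_measure_integral => //.
- move=> A mA.
  rewrite -[leLHS]/(ca_jpos nu A) -[leRHS]/(ca_jpos mu A) !ca_jpos_ge0//.
  by rewrite lee_fin numu.
- exact/measurable_EFinP.
Qed.

Lemma ca_integral_indic mu (A : set T) : measurable A ->
  ca_integral mu (\1_A : T -> R) = (mu A)%:E.
Proof.
by move=> mA; rewrite /ca_integral !integral_indic// !setIT ca_decomp.
Qed.

(** Evaluation at X is a coordinate projection after the map that induces the topology, hence
    continuous. *)
Lemma weakly_closed_preimage (M : set (ca T R)) (X : L0c) (B : set R) :
  Linfc X -> closed B ->
  closed [set mu : weak_topology_on Ps0 M |
    B (fine (ca_integral (\val (mu : M)) X))].
Proof.
move=> LX cB.
pose F (mu : M) : {ptws (@Linfc d T R Ps Ps0) -> R} :=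
  fun U => fine (ca_integral (\val mu) (\val U)).
pose x : @Linfc d T R Ps Ps0 := exist _ X (mem_set LX).
have cF : continuous (F : weak_topology_on Ps0 M -> _).
  exact: initial_continuous.
have cx : continuous
  ((proj x : {ptws (@Linfc d T R Ps Ps0) -> R} -> R) \o
   (F : weak_topology_on Ps0 M -> _)).
  by move=> mu; apply: continuous_comp; [exact: cF|exact: proj_continuous].
exact: (preimage_closed (fun y _ => cx y) cB).
Qed.

Lemma Linfc_of (f : T -> R) (mf : measurable_fun setT f) (m : R) :
  0 < m -> (forall w, `|f w| <= m) -> Linfc (L0c_of Ps0 mf).
Proof.
move=> m0 fm; exists m => //.
have h : qs Ps (fun w => L0c_abs (L0c_of Ps0 mf) w = `|f w|).
  by apply: (qsI Ps0 _ (L0c_absE (L0c_of Ps0 mf)) (L0c_ofE Ps0 mf)) => w -> ->.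
exact: (L0c_le_of h (L0c_cstE Ps0 m)).
Qed.

(* Non-negativity is tested against indicators, and the polar inequality for
   [Y] against the truncations of [Y], which are bounded. *)
Lemma measure_polar_weakly_closed (M Mpos : set (ca T R)) C :
  C `<=` @L0c_pos _ _ _ Ps Ps0 -> M `<=` cac Ps ->
  (forall mu, Mpos mu <-> M mu /\ cac_pos Ps mu) ->
  weakly_closed_in Ps0 M (measure_polar Mpos C).
Proof.
move=> Cpos Mc MposE.
pose bounded_below := [set X : L0c | Linfc X /\ L0c_pos X].
pose bounded_minorants := [set X : L0c |
  [/\ Linfc X, L0c_pos X & exists2 Y, C Y & X <= Y]].
rewrite /weakly_closed_in.
rewrite (_ : mkset _ =
  (\bigcap_(X in bounded_below) [set mu : weak_topology_on Ps0 M |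
     [set r : R | 0 <= r] (fine (ca_integral (\val (mu : M)) X))]) `&`
  (\bigcap_(X in bounded_minorants) [set mu : weak_topology_on Ps0 M |
     [set r : R | r <= 1] (fine (ca_integral (\val (mu : M)) X))])).
  apply: closedI; apply: closed_bigI => X.
    by move=> [LX _]; apply: weakly_closed_preimage => //; exact: closed_ge.
  by move=> [LX _ _]; apply: weakly_closed_preimage => //; exact: closed_le.
apply/seteqP; split=> -[mu Mmu] /=.
  move=> [/MposE[_ muc] mupol].
  have int_ge0 X : L0c_pos X -> (0 <= ca_integral mu X)%E.
    move=> /L0c_pos_representative[x [mx x0 Xx]].
    rewrite (@qs_ca_integral _ _ _ Ps _ X x)//; last by case: muc.
    rewrite ca_integral_ge0E; last by case: muc.
    by apply: integral_ge0 => w _; rewrite lee_fin.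
  split=> X [LX Xpos] /=; first by rewrite fine_ge0// int_ge0.
  move=> [Y CY XY].
  have XY1 : (ca_integral mu X <= 1)%E.
    apply: le_trans (mupol _ CY).
    have [x [mx x0 Xx]] := L0c_pos_representative Xpos.
    have [y [my y0 Yy]] := L0c_pos_representative (Cpos _ CY).
    have Yxy : qs Ps (fun w => Y w = Num.max (x w) (y w)).
      have h := qsI Ps0 (fun w a b => conj a b) Xx Yy.
      move/L0c_leP : XY => XY.
      by apply: (qsI Ps0 _ XY h) => w xy [ex ey]; rewrite ey max_r// -ex -ey.
    have mxy : measurable_fun setT (fun w => Num.max (x w) (y w)).
      exact: measurable_maxr.
    rewrite (@qs_ca_integral _ _ _ Ps _ X x)//; last by case: muc.
    rewrite (@qs_ca_integral _ _ _ Ps _ Y _ _ _ mxy Yxy)//; last by case: muc.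
    have [mu0 _] := (cac_posP Ps mu).1 muc.
    rewrite !ca_integral_ge0E//; apply: ge0_le_integral => //.
    - by move=> w _; rewrite lee_fin.
    - exact/measurable_EFinP.
    - exact/measurable_EFinP.
    - by move=> w _; rewrite lee_fin le_max lexx.
  rewrite -lee_fin fineK//; rewrite ge0_fin_numE ?int_ge0//.
  exact: le_lt_trans XY1 (ltry 1).
move=> [mupos mumin].
have Mmu' : M mu by exact: set_mem.
have muc := Mc _ Mmu'.
have mu0 A : measurable A -> 0 <= mu A.
  move=> mA; have mind : measurable_fun setT (\1_A : T -> R).
    exact: measurable_indic.
  have : 0 <= fine (ca_integral mu (L0c_of Ps0 mind)).
    apply: mupos; split.
      apply: (@Linfc_of _ _ 1) => // w.
      by rewrite ger0_norm// indicE; case: (_ \in _).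
    by apply: (L0c_le_of (L0c_zeroE Ps0) (L0c_ofE _ _)) => w.
  rewrite (@qs_ca_integral _ _ _ Ps _ _ (\1_A : T -> R))//; last exact: L0c_ofE.
  by rewrite ca_integral_indic.
have mucp : cac_pos Ps mu by split.
split=> [|Y CY]; first by apply/MposE.
have [y [my y0 Yy]] := L0c_pos_representative (Cpos _ CY).
rewrite (@qs_ca_integral _ _ _ Ps _ Y y)// ca_integral_ge0E//.
have m1 : measurable_fun setT (cst 1 : T -> R) by [].
have := ge0_integral_truncation_le (c := 1%E) (mu := ca_jpos mu) m1 my
  (fun=> ler01) y0.
rewrite (eq_integral (fun w => (y w)%:E)) => [|w _]; last by rewrite mul1r.
apply=> n.
have mt : measurable_fun setT (fun w => Num.min (y w) n%:R).
  exact: measurable_minr.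
have t0 w : 0 <= Num.min (y w) n%:R by rewrite le_min y0 ler0n.
have tn w : Num.min (y w) n%:R <= n%:R by rewrite ge_min lexx orbT.
rewrite (eq_integral (fun w => (Num.min (y w) n%:R)%:E)) => [|w _];
  last by rewrite mul1r.
have : fine (ca_integral mu (L0c_of Ps0 mt)) <= 1.
  apply: mumin; split.
  - apply: (@Linfc_of _ _ (n%:R + 1)) => [|w]; first by rewrite ltr_wpDl.
    by rewrite ger0_norm// (le_trans (tn w))// lerDl.
  - by apply: (L0c_le_of (L0c_zeroE Ps0) (L0c_ofE _ _)) => w.
  - exists Y => //; apply: (L0c_le_of (L0c_ofE _ _) Yy) => w.
    by rewrite ge_min lexx.
rewrite (@qs_ca_integral _ _ _ Ps _ _ _ _ _ mt (L0c_ofE Ps0 mt))//.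
rewrite ca_integral_ge0E// -lee_fin fineK//.
(* An infinite integral would be sent to 0 by [fine], so finiteness has to be secured: the truncated
   integral is at most n times the finite total mass. *)
rewrite ge0_fin_numE; last by apply: integral_ge0 => w _; rewrite lee_fin.
apply: (@le_lt_trans _ _ (\int[ca_jpos mu]_w (cst n%:R%:E w))%E).
  apply: ge0_le_integral => //.
  - by move=> w _; rewrite lee_fin.
  - exact/measurable_EFinP.
  - by move=> w _; rewrite lee_fin.
rewrite integral_cst//; apply: lte_mul_pinfty => //.
by rewrite -ge0_fin_numE// fin_num_measure.
Qed.

End measure_polars.

(** Some [Q] in [Qs] detects that X is outside [C]. Keeping track of [Qs] serves both sensitivity,
    where it is all of [Pc], and a reduction set of supported probabilities. *)
Lemma reduction_set_separation (d : measure_display) (T : measurableType d)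
    (R : realType) (Ps : set (probability T R)) (Ps0 : Ps !=set0) (C : set (L0c Ps0))
    (Qs : set (probability T R)) (X : L0c Ps0) :
  C !=set0 -> C `<=` @L0c_pos d T R Ps Ps0 ->
  convex_set (C : set (convex_lmodType (L0c Ps0))) -> solid C ->
  seq_order_closed C -> Qs `<=` Pc Ps ->
  C = \bigcap_(Q in Qs) (jmap Q @^-1` (jmap Q @` C)) ->
  L0c_pos X -> ~ C X ->
  exists2 QZ, Qs QZ.1 /\ prob_polar C QZ &
    (1 < 'E_QZ.1[(QZ.2 : T -> R) \* (X : T -> R)])%E.
Proof.
move=> C0 Cpos cC sC oC QsPc CE Xpos nCX.
have [Q QsQ nX] : exists2 Q, Qs Q & ~ (jmap Q @` C) (jmap Q X).
  apply: contra_notP nCX => nX; rewrite CE => Q QsQ.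
  by apply: contrapT => nXQ; apply: nX; exists Q.
have [Z Zpol ZX] :=
  prob_polar_separation C0 Cpos cC sC oC (QsPc _ QsQ) Xpos nX.
by exists (Q, Z).
Qed.

Theorem corollary6p5 (d : measure_display) (T : measurableType d)
    (R : realType) (Ps : set (probability T R)) (Ps0 : Ps !=set0)
    (C : set (L0c Ps0)) (C0 : C !=set0) (Cpos : C `<=` @L0c_pos d T R Ps Ps0) :
  [/\ (* (i) *)
      measure_bipolar (cac_pos Ps) C = prob_bipolar C /\
      (C = measure_bipolar (cac_pos Ps) C <->
        [/\ convex_set (C : set (convex_lmodType (L0c Ps0))),
            solid C, seq_order_closed C & Pc_sensitive C]),
      (* (ii) *)
      (forall Qs : set (probability T R),
        convex_set (C : set (convex_lmodType (L0c Ps0))) ->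
        solid C -> seq_order_closed C -> Pc_sensitive C ->
        reduction_set Qs C -> (forall Q, Qs Q -> supported Ps Q) ->
        C = prob_bipolar C /\ C = measure_bipolar (scac_pos Ps) C) &
      (* (iii) *)
      [/\ convex_set
            (measure_polar (cac_pos Ps) C : set (convex_lmodType (ca T R))),
          solid_in (cac_pos Ps) (measure_polar (cac_pos Ps) C) &
          weakly_closed_in Ps0 (cac Ps) (measure_polar (cac_pos Ps) C)] /\
      [/\ convex_set
            (measure_polar (scac_pos Ps) C : set (convex_lmodType (ca T R))),
          solid_in (scac_pos Ps) (measure_polar (scac_pos Ps) C) &
          weakly_closed_in Ps0 (scac Ps) (measure_polar (scac_pos Ps) C)]].
Proof.
have subbip : C `<=` prob_bipolar C.
  by move=> X CX; split; [exact: Cpos|move=> QZ [_ _ _]; exact].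
have bipE := measure_bipolar_cac Cpos.
have bipolar_thm : convex_set (C : set (convex_lmodType (L0c Ps0))) ->
    solid C -> seq_order_closed C -> Pc_sensitive C -> C = prob_bipolar C.
  move=> cC sC oC CE; apply/seteqP; split=> // X [Xpos Xbip].
  apply: contrapT => nCX.
  (* Sensitivity is the reduction property for [Pc] itself. *)
  have [QZ [_ QZpol]] := reduction_set_separation C0 Cpos cC sC oC
    (@subset_refl _ _) CE Xpos nCX.
  by rewrite ltNge Xbip.
split; [split=> //; split|..].
- rewrite bipE => ->; split; [exact: prob_bipolar_convex|
    exact: prob_bipolar_solid|exact: prob_bipolar_seq_order_closed|
    exact: prob_bipolar_sensitive].
- by move=> [cC sC oC CE]; rewrite bipE; exact: bipolar_thm.
- move=> Qs cC sC oC CE [_ QsPc QsE] Qsupp; split; first exact: bipolar_thm.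
  apply/seteqP; split=> [X CX|X [Xpos Xbip]].
    by split; [exact: Cpos|move=> mu [_]; exact].
  apply: contrapT => nCX.
  have [[Q Z] [/= QsQ [/= PcQ Zb Zpos Zpol]]] :=
    reduction_set_separation C0 Cpos cC sC oC QsPc QsE Xpos nCX.
  (* The separating [Q] lies in the reduction set and is supported, so its density by Z is a
     supported measure that violates the bipolar inequality for X. *)
  have [mu [_ musc muE]] := prob_density_cac_pos PcQ Zb Zpos.
  rewrite -muE// ltNge Xbip//; split; first exact/musc/Qsupp.
  by move=> Y CY; rewrite muE; [exact: Zpol|exact: Cpos].
split; split.
- apply: measure_polar_convex => // mu nu s t s0 t0.
  exact: cac_pos_comb (ltW s0) (ltW t0).
- exact: measure_polar_solid.
- apply: measure_polar_weakly_closed => // mu; split=> [muc|[]//].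
  by split=> //; case: muc.
- apply: measure_polar_convex => //; first by move=> mu [].
  by move=> mu nu s t; exact: scac_comb.
- by apply: measure_polar_solid => // mu [].
- by apply: measure_polar_weakly_closed => // mu [].
Qed.
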